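(* Let $\widetilde{\boldsymbol{\pi}}$ be the initial probability of starting the Markov mixture process $X$ on the finite state space $\mathbb{S}$. Let $\mathbf{L}^{Q^{(k)}}(t)$ be the likelihood matrix whose $(i,j)$ element is $\mathbf{L}^{Q^{(k)}}_{i,j}(t)=\mathbb{P}\{\mathcal{F}_{t,j}\mid\phi=k,X_0=i\}$. Then, for $j\in\mathbb{S}$ and $t\ge0$, the Bayesian update $s_j^{(k)}(t)=\mathbb{P}\{\phi=k\mid\mathcal{F}_{t,j}\}$ of the switching probability is $$s_j^{(k)}(t)=\frac{\widetilde{\boldsymbol{\pi}}^{\top}\widetilde{\mathbf{S}}^{(k)}\mathbf{L}^{Q^{(k)}}(t)\mathbf{e}_j}{\sum_{l=1}^m\widetilde{\boldsymbol{\pi}}^{\top}\widetilde{\mathbf{S}}^{(l)}\mathbf{L}^{Q^{(l)}}(t)\mathbf{e}_j},\qquad k=1,\dots,m.$$ More precisely, depending on the availability of the information set $\mathcal{F}_{t-}$: (i) under full information $\mathcal{F}_{t,j}=\{X_s,\,0\le s\le t-\}\cup\{X_t=j\}$, with $i_0$ the initial state, $$s_j^{(k)}(t)=\frac{s_{i_0}^{(k)}\mathbf{L}^{Q^{(k)}}_{i_0,j}(t)}{\sum_{l=1}^m s_{i_0}^{(l)}\mathbf{L}^{Q^{(l)}}_{i_0,j}(t)};$$ (ii) under partial information $\mathcal{F}_{t,j}=\{X_t=j\}$, $$s_j^{(k)}(t)=\frac{\widetilde{\boldsymbol{\pi}}^{\top}\widetilde{\mathbf{S}}^{(k)}\exp(\mathbf{Q}^{(k)}t)\mathbf{e}_j}{\sum_{l=1}^m\widetilde{\boldsymbol{\pi}}^{\top}\widetilde{\mathbf{S}}^{(l)}\exp(\mathbf{Q}^{(l)}t)\mathbf{e}_j};$$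 (iii) under partial information $\mathcal{F}_{t,j}=\{X_0=i_0\}\cup\{X_t=j\}$, $$s_j^{(k)}(t)=\frac{\mathbf{e}_{i_0}^{\top}\widetilde{\mathbf{S}}^{(k)}\exp(\mathbf{Q}^{(k)}t)\mathbf{e}_j}{\sum_{l=1}^m\mathbf{e}_{i_0}^{\top}\widetilde{\mathbf{S}}^{(l)}\exp(\mathbf{Q}^{(l)}t)\mathbf{e}_j}.$$
   Context: Mixture process: $\mathbb{S}=\{1,\dots,n+1\}$, and $X^{(1)},\dots,X^{(m)}$ are Markov jump processes on $\mathbb{S}$ with right-continuous sample paths and intensity matrices $\mathbf{Q}^{(1)},\dots,\mathbf{Q}^{(m)}$ (nonnegative off-diagonal entries $q^{(k)}_{ij}$, zero row sums); $q_i^{(k)}=-q_{ii}^{(k)}$. The mixture process $X$ equals $X^{(k)}$ when $\phi=k$, where $\phi\in\{1,\dots,m\}$ is an unobservable speed regime. The initial law is $\mathbb{P}\{X_0=i\}=\widetilde\pi_i$, and $\mathbb{P}\{\phi=k\mid X_0=i\}=s_i^{(k)}$ with $0\le s_i^{(k)}\le1$ and $\sum_{k=1}^m s_i^{(k)}=1$. Set $\widetilde{\mathbf{S}}^{(k)}=\mathrm{diag}(s_1^{(k)},\dots,s_{n+1}^{(k)})$; $\mathbf{e}_j$ is the $j$th unit column vector. Information: $\mathcal{F}_{t-}$ denotes the available previous information about $X$ prior to time $t$; it may contain full information, partial information, or nothing about the past of $X$. $\mathcal{F}_{t,j}=\mathcal{F}_{t-}\cup\{X_t=j\}$ is this information together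 with the observation $X_t=j$. Likelihood: $\mathbf{L}^{Q^{(k)}}_{i,j}(t)=\mathbb{P}\{\mathcal{F}_{t,j}\mid\phi=k,X_0=i\}$ is the likelihood of observing the past realization $\mathcal{F}_{t,j}$ of $X$ when it moves according to $X^{(k)}$, given the initial state $i$. For an observed path it is given by $$\mathbf{L}^{Q^{(k)}}_{i,j}(t)=\prod_{l\in\mathbb{S}}\exp\big(-q_l^{(k)}T_l\big)\prod_{r\ne l,\,r\in\mathbb{S}}\big(q_{lr}^{(k)}\big)^{N_{lr}},$$ where $T_l$ is the total time spent by the observed process in state $l$ and $N_{lr}$ is the number of transitions from $l$ to $r$ observed in $\mathcal{F}_{t,j}$. When $\mathcal{F}_{t-}=\emptyset$ (no past information), $\mathbf{L}^{Q^{(k)}}(t)=\exp(\mathbf{Q}^{(k)}t)$. *)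

(* Defs.v *)
From HB Require Import structures.
From mathcomp Require Import all_boot all_order all_algebra finmap.
From mathcomp Require Import all_classical all_reals all_analysis.

Set Implicit Arguments.
Unset Strict Implicit.
Unset Printing Implicit Defensive.

Import Order.TTheory GRing.Theory Num.Theory.
Import numFieldNormedType.Exports.

Local Open Scope classical_set_scope.
Local Open Scope ring_scope.

(* States are numbered from 0: 'I_n.+1 stands for {1, ..., n+1}, and the speed
   regimes {1, ..., m} are 'I_m. *)

Definition expmx (R : realType) (n : nat) (A : 'M[R]_n.+1) : 'M[R]_n.+1 :=
  limn (series (fun p : nat => (p`!%:R)^-1 *: A ^+ p)).

Definition is_intensity (R : realType) (n : nat) (Q : 'M[R]_n.+1) : Prop :=
  (forall i j, i != j -> 0 <= Q i j) /\ (forall i, \sum_j Q i j = 0).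

(* Elementary conditional probability; it has its usual meaning only when
   mu B != 0, and is 0 otherwise. *)
Definition cprob (R : realType) (T : Type) (mu : set T -> \bar R)
    (A B : set T) : R :=
  fine (mu (A `&` B)) / fine (mu B).

Definition cond_law (R : realType) (T : Type) (mu : set T -> \bar R)
    (B : set T) : set T -> \bar R :=
  fun A => (cprob mu A B)%:E.

(* Under the law mu, X is a time-homogeneous Markov jump process with intensity
   matrix Q, that is, with transition matrices exp(Q h). The list r is a finite
   record of times before s and of the states occupied at these times. Paths
   are right-continuous for the discrete topology on the states; negative times
   are irrelevant. *)
Definition markov_jump (R : realType) (n : nat) (d : measure_display)
    (T : measurableType d) (mu : set T -> \bar R) (Q : 'M[R]_n.+1)
    (X : R -> T -> 'I_n.+1) : Prop :=
  [/\ forall s i, 0 <= s -> measurable [set w | X s w = i],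
      forall w s, 0 <= s -> \forall u \near s^'+, X u w = X s w &
      forall (r : seq (R * 'I_n.+1)) (s h : R) (i j : 'I_n.+1),
        0 <= s -> 0 <= h -> all (fun p => 0 <= p.1 < s) r ->
        let past := [set w | all (fun p => X p.1 w == p.2) r] in
        let B := past `&` [set w | X s w = i] in
        mu B != 0%E ->
        cprob mu [set w | X (s + h) w = j] B = expmx (h *: Q) i j].

Definition mixture (R : realType) (n m : nat) (T : Type)
    (phi : T -> 'I_m) (Xk : 'I_m -> R -> T -> 'I_n.+1) : R -> T -> 'I_n.+1 :=
  fun t w => Xk (phi w) t w.

(* The sigma-algebra generated by X_s, 0 <= s < t. *)
Definition past_sigma (R : realType) (n : nat) (T : Type)
    (X : R -> T -> 'I_n.+1) (t : R) : set_system T :=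
  <<s [set A | exists s i, 0 <= s < t /\ A = [set w | X s w = i]] >>.

(* g is a version of P{E | F, B}, for a sub-sigma-algebra F and a further
   observed event B: on B, the conditional probability of E given F under the
   law P( . | B). *)
Definition is_cond_prob (R : realType) (d : measure_display)
    (T : measurableType d) (P : probability T R) (F : set_system T)
    (B E : set T) (g : T -> R) : Prop :=
  [/\ forall U, measurable U -> F (g @^-1` U),
      P.-integrable B (EFin \o g) &
      forall A, F A ->
        P (E `&` (A `&` B)) = (\int[P]_(w in A `&` B) (g w)%:E)%E].

(* The likelihood P{F_{t,j} | phi = k, X_0 = i} of the information observed
   before t together with X_t = j, when that information is an event F. *)
Definition event_likelihood (R : realType) (n m : nat) (d : measure_display)
    (T : measurableType d) (P : probability T R) (phi : T -> 'I_m)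
    (X : R -> T -> 'I_n.+1) (t : R) (F : set T) (k : 'I_m) : 'M[R]_n.+1 :=
  \matrix_(i, j) cprob P (F `&` [set w | X t w = j])
                   ([set w | phi w = k] `&` [set w | X 0 w = i]).

(* The same likelihood when the information is the realization y of a random
   element Y whose individual values may have probability 0: L k y i j is the
   density at y, with respect to a dominating measure nu, of the conditional
   law of Y on X_t = j given phi = k and X_0 = i. *)
Definition is_likelihood (R : realType) (n m : nat) (d : measure_display)
    (T : measurableType d) (P : probability T R) (phi : T -> 'I_m)
    (X : R -> T -> 'I_n.+1) (t : R) (d' : measure_display)
    (Z : measurableType d') (Y : T -> Z) (nu : {measure set Z -> \bar R})
    (L : 'I_m -> Z -> 'M[R]_n.+1) : Prop :=
  [/\ forall k i j, measurable_fun setT (fun y => L k y i j),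
      forall k y i j, 0 <= L k y i j &
      forall k i j,
        P ([set w | phi w = k] `&` [set w | X 0 w = i]) != 0%E ->
        forall V, measurable V ->
        (cprob P (Y @^-1` V `&` [set w | X t w = j])
           ([set w | phi w = k] `&` [set w | X 0 w = i]))%:E
        = (\int[nu]_(y in V) (L k y i j)%:E)%E].

Definition occupation_time (R : realType) (n : nat) (x : R -> 'I_n.+1)
    (t : R) (l : 'I_n.+1) : R :=
  fine (lebesgue_measure [set u : R | 0 <= u <= t /\ x u = l]).

(* fset_set sends an infinite set to the empty one, so the count is meaningful
   only for paths with finitely many jumps from l to r. *)
Definition transition_count (R : realType) (n : nat) (x : R -> 'I_n.+1)
    (t : R) (l r : 'I_n.+1) : nat :=
  #|` fset_set [set u : R | 0 < u <= t /\
                            ((\forall v \near u^'-, x v = l) /\ x u = r)] |.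

Definition path_likelihood (R : realType) (n : nat) (Q : 'M[R]_n.+1)
    (x : R -> 'I_n.+1) (t : R) : R :=
  \prod_l (expR (- (- Q l l) * occupation_time x t l) *
           \prod_(r | r != l) Q l r ^+ transition_count x t l r).

Definition regime_weight (R : realType) (n m : nat) (pi0 : 'cV[R]_n.+1)
    (s : 'I_m -> 'rV[R]_n.+1) (L : 'I_m -> 'M[R]_n.+1)
    (j : 'I_n.+1) (k : 'I_m) : R :=
  (pi0^T *m diag_mx (s k) *m L k *m (delta_mx j 0 : 'cV[R]_n.+1)) 0 0.

Definition bayes_update (R : realType) (n m : nat) (pi0 : 'cV[R]_n.+1)
    (s : 'I_m -> 'rV[R]_n.+1) (L : 'I_m -> 'M[R]_n.+1)
    (j : 'I_n.+1) (k : 'I_m) : R :=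
  regime_weight pi0 s L j k / \sum_l regime_weight pi0 s L j l.

(* Main.v *)
(* When the information is an event, or is observed through a density, Bayes'
   formula is a summation over the pairs (regime, initial state), whose law is
   pi0 i * s k i.

   For the whole past on [0, t), sample the path on the dyadic grid of mesh
   t / 2^q. The Markov property makes the law of (regime, samples) an explicit
   product of entries of exp((t / 2^q) Q k), so Bayes' formula is exact for each
   q. Along a path with finitely many jumps, group the product according to the
   pair of states at the ends of each step: for q large, the number of (a, b)
   steps with a <> b is the number of transitions from a to b, and the mesh
   times the number of (a, a) steps tends to the time spent in a. Hence, after
   division by the mesh to the power of the number of jumps, the product tends
   to the path likelihood, and the grid posteriors tend to the ratio in (i). The
   expected number of changes along the grid is bounded uniformly in q, so
   almost every path has finitely many jumps; a transition of rate 0 has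
   probability O(mesh^2) at each step, so almost surely none occurs and the
   limiting denominator is positive. Dominated convergence carries Bayes'
   formula to cylinder events, and the pi-lambda theorem to the whole past. *)
Require Import Defs.
From HB Require Import structures.
From mathcomp Require Import all_boot all_order all_algebra finmap.
From mathcomp Require Import all_classical all_reals all_analysis.
From mathcomp Require Import measurable_realfun.
From mathcomp Require Import ring lra.

Set Implicit Arguments.
Unset Strict Implicit.
Unset Printing Implicit Defensive.

Import Order.TTheory GRing.Theory Num.Theory.
Import numFieldNormedType.Exports.

Local Open Scope classical_set_scope.
Local Open Scope ring_scope.

(** * The matrix exponential at small times *)

Lemma cvg_mx_entry (R : realType) (n : nat) (u : nat -> 'M[R]_n.+1)
    (l : 'M[R]_n.+1) :
  (forall i j, u p i j @[p --> \oo] --> l i j) -> u @ \oo --> l.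
Proof.
move=> ul; apply/cvg_ballP => e e0.
have H : \forall p \near \oo, forall ij : 'I_n.+1 * 'I_n.+1,
    ball (l ij.1 ij.2) e (u p ij.1 ij.2).
  by apply: filter_forall => -[i j]; move/cvg_ballP : (ul i j) => /(_ e e0).
by apply: filterS H => p Hp; split => // i j; exact: (Hp (i, j)).
Qed.

Lemma expr_mx_entry_le (R : realType) (n : nat) (A : 'M[R]_n.+1) (b : R) :
  (forall i j, `|A i j| <= b) ->
  forall p i j, `|(A ^+ p) i j| <= (n.+1%:R * b) ^+ p.
Proof.
move=> Ab; have b0 : 0 <= b := le_trans (normr_ge0 _) (Ab 0 0).
elim=> [|p IH] i j.
  by rewrite !expr0 mxE; case: eqP => _; rewrite /= ?normr1 ?normr0.
rewrite exprS mxE (le_trans (ler_norm_sum _ _ _))//.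
apply: (@le_trans _ _ (\sum_(k < n.+1) b * (n.+1%:R * b) ^+ p)).
  by apply: ler_sum => k _; rewrite normrM ler_pM.
by rewrite sumr_const card_ord exprS -[leLHS]mulr_natl mulrA.
Qed.

Section expmx_entry.
Variables (R : realType) (n : nat) (A : 'M[R]_n.+1) (b : R).
Hypothesis Ab : forall i j, `|A i j| <= b.
Let a := n.+1%:R * b.
Hypothesis a_le : a <= 2^-1.

Let a0 : 0 <= a.
Proof. by rewrite mulr_ge0// (le_trans _ (Ab 0 0)). Qed.

Let term (p : nat) : 'M[R]_n.+1 := (p`!%:R)^-1 *: A ^+ p.

Let term_le p i j : `|term p i j| <= a ^+ p.
Proof.
rewrite mxE normrM; apply: le_trans (expr_mx_entry_le Ab p i j).
rewrite ler_piMl// ger0_norm ?invr_ge0// invf_le1 ?ltr0n ?fact_gt0//.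
by rewrite ler1n fact_gt0.
Qed.

Let term_entry i j N : series (fun p => term p i j) N = series term N i j.
Proof. by rewrite /series/= summxE. Qed.

Let cvg_entry i j : cvgn (series (fun p => term p i j)).
Proof.
apply: normed_cvg; apply: (@series_le_cvg _ _ (geometric 1 a)) => //=.
- by move=> p; rewrite mul1r exprn_ge0.
- by move=> p; rewrite mul1r term_le.
- by apply: is_cvg_geometric_series; rewrite ger0_norm// (le_lt_trans a_le)// invf_lt1// ltr1n.
Qed.

(** Domination by a geometric series makes every entry converge, hence the matrix series too.
    Without this convergence [limn] would only be a default value, unrelated to the entries. *)
Lemma expmx_entry i j : expmx A i j = limn (series (fun p => term p i j)).
Proof.
have H : series term @ \oo --> (\matrix_(i, j) limn (series (fun p => term p i j))).
  apply: cvg_mx_entry => k l; rewrite mxE.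
  under eq_fun do rewrite -term_entry.
  exact: cvg_entry.
by rewrite /expmx (cvg_lim _ H)// mxE.
Qed.

(** The terms of orders 0 and 1 are split off each partial sum. The rest is dominated by [a ^+ 2]
    times a geometric series which, thanks to [a <= 2^-1], sums to at most 2. *)
Lemma expmx_entry_approx i j :
  `|expmx A i j - ((i == j)%:R + A i j)| <= 2 * a ^+ 2.
Proof.
rewrite expmx_entry.
set l := limn _.
have H : `|series (fun p => term p i j) N - ((i == j)%:R + A i j)| @[N --> \oo]
   --> `|l - ((i == j)%:R + A i j)|.
  by apply: cvg_norm; apply: cvgB; [exact: cvg_entry|exact: cvg_cst].
rewrite -(cvg_lim _ H)//; apply: limr_le; first by apply: cvgP H.
apply: filterS (nbhs_infty_ge 2) => N N2.
have -> : N = (N - 2).+2 by rewrite -addn2 subnK.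
move: (N - 2)%N => {N2}N.
rewrite /series/= 2?big_nat_recl//= !mxE fact0 invr1 mul1r mul1r expr1.
rewrite addrA [_ + _ in X in `|X - _|]addrC -addrA subrr addr0.
rewrite (le_trans (ler_norm_sum _ _ _))//.
apply: (@le_trans _ _ (\sum_(0 <= p < N) a ^+ 2 * 2^-1 ^+ p)).
  apply: ler_sum => p _; rewrite (le_trans (term_le _ _ _))//.
  rewrite -addn2 addnC exprD ler_wpM2l ?exprn_ge0//.
  by rewrite lerXn2r ?nnegrE// invr_ge0.
rewrite -mulr_sumr mulrC ler_wpM2r ?exprn_ge0//.
suff -> : \sum_(0 <= p < N) 2^-1 ^+ p = 2 - 2 * 2^-1 ^+ N :> R.
  by rewrite gerBl mulr_ge0// exprn_ge0// invr_ge0.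
elim: N => [|N IH]; first by rewrite big_geq// expr0 mulr1 subrr.
by rewrite big_nat_recr//= IH exprS; field.
Qed.

End expmx_entry.

Section small_step.
Variables (R : realType) (n : nat) (Q : 'M[R]_n.+1) (h : R^nat).
Hypotheses (h0 : forall p, 0 < h p) (hto0 : h @ \oo --> 0).

Lemma expmx_small_step : exists2 C : R, 0 <= C &
  \forall p \near \oo, forall i j,
    `|expmx (h p *: Q) i j - ((i == j)%:R + h p * Q i j)| <= C * h p ^+ 2.
Proof.
pose B := \sum_i \sum_j `|Q i j|.
have B0 : 0 <= B by apply: sumr_ge0 => i _; exact: sumr_ge0.
have QB i j : `|Q i j| <= B.
  rewrite /B (bigD1 i)//= (bigD1 j)//= -addrA lerDl addr_ge0//.
    exact: sumr_ge0.
  by apply: sumr_ge0 => k _; exact: sumr_ge0.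
(* This is the remainder of [expmx_entry_approx] for [h p *: Q], whose entries are bounded by
   [h p * B], after division by [h p ^+ 2]. *)
exists (2 * (n.+1%:R * B) ^+ 2); first by rewrite mulr_ge0// exprn_ge0// mulr_ge0.
have H : n.+1%:R * (h p * B) @[p --> \oo] --> (0 : R).
  under eq_fun do rewrite mulrCA.
  by rewrite -(mul0r (n.+1%:R * B)); apply: cvgM => //; exact: cvg_cst.
have : \forall p \near \oo, n.+1%:R * (h p * B) < 2^-1.
  by apply: (cvgr_lt _ H); rewrite invr_gt0.
apply: filterS => p hp i j.
have := @expmx_entry_approx R n (h p *: Q) (h p * B) _ (ltW hp) i j.
rewrite mxE => /(_ _)/le_trans; apply.
  by move=> k l; rewrite mxE normrM gtr0_norm// ler_wpM2l// ltW.
by rewrite le_eqVlt; apply/orP; left; apply/eqP; ring.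
Qed.

Lemma cvg_expmx_slope i j :
  (expmx (h p *: Q) i j - (i == j)%:R) / h p @[p --> \oo] --> Q i j.
Proof.
have [C C0 H] := expmx_small_step.
apply/cvgrPdist_le => e e0.
have Ch : C * h p @[p --> \oo] --> (0 : R).
  by rewrite -(mulr0 C); apply: cvgM => //; exact: cvg_cst.
have He : \forall p \near \oo, C * h p < e by exact: (cvgr_lt _ Ch).
apply: filterS2 H He => p /(_ i j) Hp Che.
apply: le_trans (ltW Che).
have -> : Q i j - (expmx (h p *: Q) i j - (i == j)%:R) / h p =
   - (expmx (h p *: Q) i j - ((i == j)%:R + h p * Q i j)) / h p.
  by field; rewrite gt_eqF.
rewrite normrM normrN normfV (gtr0_norm (h0 p)) ler_pdivrMr//.
by rewrite -mulrA -expr2.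
Qed.

(** The logarithm of the power is [k p * h p] times [ln (y p) / h p], and the latter has the same
    limit as the slope [(y p - 1) / h p]. This produces the holding factors of the path
    likelihood. *)
Lemma cvg_expmx_diag_exp (k : nat -> nat) (tau : R) i :
  (k p)%:R * h p @[p --> \oo] --> tau ->
  expmx (h p *: Q) i i ^+ k p @[p --> \oo] --> expR (Q i i * tau).
Proof.
move=> ktau.
pose y (p : nat) : R := expmx (h p *: Q) i i.
have slope : (y p - 1) / h p @[p --> \oo] --> Q i i.
  by have := @cvg_expmx_slope i i; rewrite eqxx.
have y1 : y @ \oo --> (1 : R).
  have -> : y = (fun p => (y p - 1) / h p * h p + 1).
    by apply/funext => p; field; rewrite gt_eqF.
  rewrite -[X in _ --> X]add0r -(mulr0 (Q i i)); apply: cvgD; last exact: cvg_cst.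
  exact: cvgM.
have y0 : \forall p \near \oo, 0 < y p by apply: (cvgr_gt _ y1).
(* 1 - 1/y <= ln y <= y - 1 squeezes the logarithmic slope. *)
have lslope : ln (y p) / h p @[p --> \oo] --> Q i i.
  apply: (@squeeze_cvgr _ _ _ _ (fun p => (y p - 1) / h p / y p) (fun p => (y p - 1) / h p)).
  - apply: filterS y0 => p yp.
    rewrite mulrAC ![_ / h p]mulrC !ler_pM2l ?invr_gt0//.
    have ln_le x : 0 < x -> ln x <= x - 1 :> R.
      by move=> x0; have := @le_ln1Dx R (x - 1); rewrite addrCA subrr addr0; apply; rewrite ltrBrDl subrr.
    rewrite ln_le// andbT mulrBl divff ?gt_eqF// mul1r.
    by rewrite -[ln _]opprK -lnV ?posrE// lerNr opprB ln_le// invr_gt0.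
  - rewrite -[X in _ --> X]mulr1; apply: cvgM => //.
    by rewrite -[X in _ --> X]invr1; apply: (cvgV _ y1); exact: oner_neq0.
  - exact: slope.
have H : expR (ln (y p) / h p * ((k p)%:R * h p)) @[p --> \oo] --> expR (Q i i * tau).
  by apply: continuous_cvg; [exact: continuous_expR|exact: cvgM].
apply: cvg_trans H; apply: near_eq_cvg; apply: filterS y0 => p yp.
rewrite mulrCA divfK ?gt_eqF// -[RHS]lnK ?posrE ?exprn_gt0//.
by rewrite lnXn// mulr_natl.
Qed.

End small_step.

(** * Right-continuous paths along dyadic grids *)

Definition mesh (R : realType) (t : R) (q : nat) : R := t / 2 ^+ q.

Definition grid (R : realType) (t : R) (q i : nat) : R := i%:R * mesh t q.

(** Rounding goes upwards, so that the grid point approaches [u] from the right, the side on which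
    paths are continuous. For [u >= 0] the ceiling is nonnegative and the absolute value only
    changes its type. *)
Definition grid_index (R : realType) (t : R) (q : nat) (u : R) : nat :=
  `|Num.ceil (u / mesh t q)|%N.

Section grid_theory.
Variables (R : realType) (t : R).
Hypothesis t0 : 0 < t.

Lemma mesh_gt0 q : 0 < mesh t q.
Proof. by rewrite divr_gt0// exprn_gt0. Qed.

Lemma cvg_mesh : mesh t @ \oo --> (0 : R).
Proof.
have -> : mesh t = geometric t 2^-1.
  by apply/funext => q; rewrite /mesh /= exprVn.
by apply: cvg_geometric; rewrite ger0_norm ?invr_ge0// invf_lt1// ltr1n.
Qed.

Lemma grid_end q : grid t q (2 ^ q) = t.
Proof. by rewrite /grid /mesh natrX mulrC divfK// expf_neq0. Qed.

Lemma gridS q i : grid t q i.+1 = grid t q i + mesh t q.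
Proof. by rewrite /grid -natr1 mulrDl mul1r. Qed.

Lemma grid_le q i k : (grid t q i <= grid t q k) = (i <= k)%N.
Proof. by rewrite /grid ler_pM2r ?mesh_gt0// ler_nat. Qed.

Lemma grid_lt q i k : (grid t q i < grid t q k) = (i < k)%N.
Proof. by rewrite /grid ltr_pM2r ?mesh_gt0// ltr_nat. Qed.

Lemma grid_ge0 q i : 0 <= grid t q i.
Proof. by rewrite mulr_ge0// ltW// mesh_gt0. Qed.

Lemma grid_indexE q u : 0 <= u ->
  (grid_index t q u)%:R = (Num.ceil (u / mesh t q))%:~R :> R.
Proof.
move=> u0; rewrite /grid_index natr_absz ger0_norm// -(ler_int R).
by rewrite (le_trans _ (ceil_ge _))// divr_ge0// ltW// mesh_gt0.
Qed.

Lemma grid_index_ge q u : 0 <= u -> u <= grid t q (grid_index t q u).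
Proof.
by move=> u0; rewrite /grid grid_indexE// -ler_pdivrMr ?mesh_gt0// ceil_ge.
Qed.

Lemma grid_index_lt q u : 0 <= u ->
  grid t q (grid_index t q u) < u + mesh t q.
Proof.
move=> u0; rewrite /grid grid_indexE// -ltr_pdivlMr ?mesh_gt0// mulrDl.
rewrite divff ?gt_eqF ?mesh_gt0// -ltrBlDr.
by have := ceilB1_lt (u / mesh t q); rewrite intrB.
Qed.

Lemma grid_indexP q u i : 0 <= u -> (grid_index t q u <= i)%N = (u <= grid t q i).
Proof.
move=> u0; apply/idP/idP => [|ui].
  by rewrite -(grid_le q); apply: le_trans; exact: grid_index_ge.
by rewrite -ltnS -(grid_lt q) gridS (lt_le_trans (grid_index_lt _ u0))// lerD2r.
Qed.

Lemma grid_index_cell q u i : grid t q i < u <= grid t q i.+1 ->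
  grid_index t q u = i.+1.
Proof.
move=> /andP[iu ui]; have u0 : 0 <= u by rewrite (le_trans (grid_ge0 _ _) (ltW iu)).
apply/eqP; rewrite eqn_leq grid_indexP// ui/= ltnNge grid_indexP//.
by rewrite -ltNge.
Qed.

Lemma grid_cellP q u : 0 < u <= t -> exists2 i, (i < 2 ^ q)%N &
  grid t q i < u <= grid t q i.+1.
Proof.
move=> /andP[u0 ut].
have : (grid_index t q u != 0)%N.
  by rewrite -leqn0 grid_indexP ?(ltW u0)// /grid mulr0n mul0r -ltNge.
have : (grid_index t q u <= 2 ^ q)%N by rewrite grid_indexP ?(ltW u0)// grid_end.
case E : grid_index => [//|i] iq _; exists i => //.
by rewrite ltNge -!grid_indexP ?(ltW u0)// E ltnn leqnn.
Qed.

End grid_theory.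

(** * Jumps of a right-continuous path and its changes along the grid *)

Section right_continuous_path.
Variables (R : realType) (n : nat) (x : R -> 'I_n.+1) (t : R).
Hypothesis t0 : 0 < t.
Hypothesis rc : forall s, 0 <= s -> \forall u \near s^'+, x u = x s.

(** Right-continuity leaves the left side as the only place where the path can break. Times without
    a left limit are included, which matters before finiteness is known. *)
Definition jumps : set R :=
  [set u | 0 < u <= t /\ ~ \forall v \near u^'-, x v = x u].

Definition grid_changes (q k : nat) : nat :=
  count (fun i => x (grid t q i) != x (grid t q i.+1)) (iota 0 k).

Lemma near_path_right s : 0 <= s ->
  exists2 e : R, 0 < e & forall u, s <= u < s + e -> x u = x s.
Proof.
move=> /rc [e /= e0 H]; exists e => // u /andP[su us].
move: su; rewrite le_eqVlt => /predU1P[->//|su]; apply: H => //=.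
by rewrite ltr0_norm ?subr_lt0// opprB ltrBlDl.
Qed.

Lemma near_path_left u a : (\forall v \near u^'-, x v = a) <->
  exists2 e : R, 0 < e & forall v, u - e < v < u -> x v = a.
Proof.
split=> [[e /= e0 H]|[e e0 H]].
  exists e => // v /andP[ev vu]; apply: H => //=.
  by rewrite gtr0_norm ?subr_gt0// ltrBlDl -ltrBlDr.
exists e => //= v /=; rewrite -/(_ < _) => + vu.
by rewrite gtr0_norm ?subr_gt0// ltrBlDl -ltrBlDr => ev; apply: H; rewrite ev.
Qed.

(** The rounded time stays within one mesh to the right of [s], eventually inside an interval on
    which the path keeps its value. *)
Lemma grid_index_path s : 0 <= s ->
  \forall q \near \oo, x (grid t q (grid_index t q s)) = x s.
Proof.
move=> s0; have [e e0 H] := near_path_right s0.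
have : \forall q \near \oo, mesh t q < e by exact: (cvgr_lt _ (cvg_mesh t)).
apply: filterS => q qe; apply: H; rewrite grid_index_ge//=.
by rewrite (lt_trans (grid_index_lt t0 _ s0))// ltrD2l.
Qed.

Lemma grid_changes_eq0 q i k : (i <= k)%N ->
  grid_changes q i = grid_changes q k -> x (grid t q i) = x (grid t q k).
Proof.
move=> ik; rewrite -(subnKC ik) /grid_changes iotaD count_cat.
rewrite -[in LHS](addn0 (count _ _)) => /addnI /esym.
elim: (k - i)%N => [|d IH]; first by rewrite addn0.
rewrite -(addn1 d) iotaD count_cat => /eqP; rewrite addn_eq0 => /andP[/eqP/IH ->].
by rewrite /= addn0 addnA addn1 eqb0 negbK => /eqP.
Qed.

Lemma grid_changes_mono q i k : (i <= k)%N ->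
  (grid_changes q i <= grid_changes q k)%N.
Proof. by move=> ik; rewrite /grid_changes -(subnKC ik) iotaD count_cat leq_addr. Qed.

Lemma jump_witness u w : jumps u -> w < u -> exists2 v, w < v < u & x v <> x u.
Proof.
move=> [_ nu] wu; apply: contrapT => H; apply: nu; apply/near_path_left.
exists (u - w); rewrite ?subr_gt0// => v; rewrite subKr => wvu.
by apply: contrapT => ne; apply: H; exists v.
Qed.

(** Just before a jump [u] there is a time [v] with another value, and fine grids reproduce the
    values at both, so at least one change occurs between their grid points. The induction removes
    the latest jump and restarts with [v] in place of [s], whence the decreasing list. *)
Lemma jumps_grid_changes (l : seq R) (s : R) :
  sorted >%R l -> (forall u, u \in l -> jumps u /\ u <= s) ->
  \forall q \near \oo, (size l <= grid_changes q (grid_index t q s))%N.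
Proof.
elim: l s => [|u l IH] s /=; first by move=> _ _; exact: nearW.
move=> ul H.
have [ju us] : jumps u /\ u <= s by apply: H; rewrite mem_head.
have u0 : 0 < u by case: ju => /andP[].
(* The preceding jump, or time 0 if there is none: a witness taken after [w] comes later than all
   remaining jumps. *)
pose w := if l is v :: _ then v else 0.
have [wu w0 wl] : [/\ w < u, 0 <= w & forall v, v \in l -> v <= w].
  rewrite /w; case: l ul H {IH w} => [|v l] /=; first by move=> *; split.
  move=> /andP[vu vl] H; split => //.
    by have [[/andP[/ltW]]] : jumps v /\ v <= s by apply: H; rewrite !inE eqxx orbT.
  move=> v'; rewrite in_cons => /predU1P[->//|v'l].
  by apply/ltW; move: vl; rewrite (path_sortedE (rev_trans lt_trans)) => /andP[/allP /(_ _ v'l)].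
have [v /andP[wv vu] xvu] := jump_witness ju wu.
have v0 : 0 <= v by rewrite (le_trans w0)// ltW.
have Hv := IH v (path_sorted ul) (fun z zl => conj
  (H z (mem_behead (s := u :: l) zl)).1 (le_trans (wl z zl) (ltW wv))).
apply: filterS3 Hv (grid_index_path v0) (grid_index_path (ltW u0)) => q Hq xv xu.
have vuq : (grid_index t q v <= grid_index t q u)%N.
  by rewrite grid_indexP// (le_trans (ltW vu))// grid_index_ge// ltW.
have usq : (grid_index t q u <= grid_index t q s)%N.
  have s0 : 0 <= s by rewrite (le_trans (ltW u0)).
  by rewrite grid_indexP ?(ltW u0)// (le_trans us)// grid_index_ge.
apply: leq_trans (grid_changes_mono _ usq); apply: (leq_ltn_trans Hq).
rewrite ltn_neqAle grid_changes_mono// andbT; apply/eqP => E.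
by apply: xvu; rewrite -xv -xu; exact: grid_changes_eq0 E.
Qed.

(** An infinite set of jumps contains [M] of them, and these would force [M] changes on every fine
    grid. *)
Lemma finite_jumps (M : nat) :
  ~ (\forall q \near \oo, (M <= grid_changes q (2 ^ q))%N) ->
  finite_set jumps.
Proof.
move=> nM; apply: contrapT => /infinite_set_fset -/(_ M)[B BJ MB]; apply: nM.
pose l := rev (sort <=%R (enum_fset B)).
have lB u : (u \in l) = (u \in B) by rewrite mem_rev mem_sort.
have : \forall q \near \oo, (size l <= grid_changes q (grid_index t q t))%N.
  apply: jumps_grid_changes.
    by rewrite rev_sorted sort_lt_sorted fset_uniq.
  by move=> u; rewrite lB => /BJ[uB ?]; split => //; case/andP : uB.
apply: filterS => q; rewrite size_rev size_sort => /(leq_trans MB) /leq_trans; apply.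
by apply: grid_changes_mono; rewrite grid_indexP ?(ltW t0)// grid_end.
Qed.

(** Let [c] be the supremum of the times up to which the value at [a] persists. Absence of a jump at
    [c] carries the value from the left to [c], and right-continuity then carries it beyond [c]
    unless [c = b]. *)
Lemma path_constant a b : 0 <= a -> a <= b -> b <= t ->
  (forall u, a < u <= b -> ~ jumps u) -> x b = x a.
Proof.
move=> a0 ab bt nj.
pose E := [set u | a <= u <= b /\ forall v, a <= v <= u -> x v = x a].
have Ea : E a.
  by split; [rewrite lexx|move=> v; rewrite -eq_le => /eqP ->].
have supE : has_sup E by split; [exists a|exists b => u [/andP[]]].
pose c := sup E.
have ac : a <= c by exact: ub_le_sup supE.2 _ Ea.
have cb : c <= b by apply: ge_sup; [exists a|move=> u [/andP[]]].
have xlt v : a <= v < c -> x v = x a.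
  move=> /andP[av vc]; have [u [_ Eu] vu] := sup_gt (ex_intro _ a Ea) vc.
  by apply: Eu; rewrite av ltW.
have xc : x c = x a.
  have [->//|ca] := eqVneq c a.
  have {}ca : a < c by rewrite lt_neqAle eq_sym ca.
  have : \forall v \near c^'-, x v = x c.
    apply: contrapT => ncl; apply: (nj c); first by rewrite ca.
    by split => //; rewrite (le_lt_trans a0 ca) (le_trans cb).
  move=> /near_path_left[e e0 He].
  (* A time in []a, c[] that also lies in the left neighbourhood of [c] where the path equals
     [x c]. *)
  pose v := Num.max ((a + c) / 2) (c - e / 2).
  have vc : v < c by rewrite /v gt_max; apply/andP; split; lra.
  rewrite -(He v); last first.
    by rewrite vc andbT /v lt_max; apply/orP; right; lra.
  by apply: xlt; rewrite vc andbT /v le_max; apply/orP; left; lra.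
have [<-//|cb'] := eqVneq c b.
have {}cb' : c < b by rewrite lt_neqAle cb'.
have [e e0 He] := near_path_right (le_trans a0 ac).
pose u := Num.min b (c + e / 2).
have cu : c < u by rewrite /u lt_min cb'/=; lra.
suff Eu : E u.
  by have := ub_le_sup supE.2 Eu; rewrite leNgt cu.
split; first by rewrite (le_trans ac (ltW cu)) /u ge_min lexx.
move=> v /andP[av vu]; have [vc|cv] := ltP v c; first by apply: xlt; rewrite av.
rewrite -xc; apply: He; rewrite cv/= (le_lt_trans vu)//.
by rewrite /u gt_min; apply/orP; right; lra.
Qed.

Definition transitions (a b : 'I_n.+1) : set R :=
  [set u : R | 0 < u <= t /\ ((\forall v \near u^'-, x v = a) /\ x u = b)].

Lemma transitions_jumps a b : a != b -> transitions a b `<=` jumps.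
Proof.
move=> ab u [u0t [ua ub]]; split => // uu; move/eqP : ab; apply.
have H : \forall v \near u^'-, x v = a /\ x v = x u by exact: filterI.
by have [v [va vu]] := @filter_ex _ _ (at_left_proper_filter u) _ H; rewrite -va vu.
Qed.

Definition step_count (q : nat) (a b : 'I_n.+1) : nat :=
  count (fun i => (x (grid t q i), x (grid t q i.+1)) == (a, b)) (iota 0 (2 ^ q)).

Hypothesis fin : finite_set jumps.

(** Under this condition each half-open cell contains at most one jump. *)
Definition separating (q : nat) : Prop :=
  forall u v, jumps u -> jumps v -> u < v -> mesh t q < v - u.

Lemma near_separating : \forall q \near \oo, separating q.
Proof.
have [d dE] := finite_fsetP.1 fin.
have H : \forall q \near \oo, forall p : d * d,
    fsval p.1 < fsval p.2 -> mesh t q < fsval p.2 - fsval p.1.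
  apply: filter_forall => -[u v] /=; have [uv|] := ltP (fsval u) (fsval v).
    have H : \forall q \near \oo, mesh t q < fsval v - fsval u.
      by apply: (cvgr_lt _ (cvg_mesh t)); rewrite subr_gt0.
    by apply: filterS H.
  by move=> _; exact: nearW.
apply: filterS H => q H u v ju jv uv.
have ud : u \in d by move: ju; rewrite dE.
have vd : v \in d by move: jv; rewrite dE.
exact: (H ([` ud]%fset, [` vd]%fset)).
Qed.

Section separated.
Variables (q : nat) (sep : separating q).

(** Since [u] is the only jump of its cell, [path_constant] applies on the part of the cell before
    [u] and on the part after it. *)
Lemma cell_jump i u : (i < 2 ^ q)%N -> jumps u ->
  grid t q i < u <= grid t q i.+1 ->
  (\forall v \near u^'-, x v = x (grid t q i)) /\ x (grid t q i.+1) = x u.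
Proof.
move=> iq ju /andP[iu ui].
have i1t : grid t q i.+1 <= t by rewrite -[leRHS](grid_end t q) grid_le.
have nj w : grid t q i < w <= grid t q i.+1 -> w != u -> ~ jumps w.
  move=> /andP[iw wi]; rewrite neq_lt => /orP[wu|uw] jw.
  - by have := sep jw ju wu; move: ui; rewrite gridS; lra.
  - by have := sep ju jw uw; move: wi; rewrite gridS; lra.
split.
  apply/near_path_left; exists (u - grid t q i); first by rewrite subr_gt0.
  move=> v; rewrite subKr => /andP[iv vu]; apply: path_constant.
  - exact: grid_ge0.
  - exact: ltW.
  - by rewrite (le_trans (ltW vu))// (le_trans ui).
  - move=> w /andP[iw wv]; have wu := le_lt_trans wv vu; apply: nj.
      by rewrite iw (le_trans (ltW wu)).
    by rewrite lt_eqF.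
apply: path_constant => //.
- by rewrite (le_trans (grid_ge0 t0 q i))// ltW.
- move=> w /andP[uw wi]; apply: nj; first by rewrite (lt_trans iu).
  by rewrite gt_eqF.
Qed.

(** With a single jump in the cell, nothing can undo it before the right end, so the end values
    differ; without a jump the path is constant. *)
Lemma cell_changeP i : (i < 2 ^ q)%N ->
  (exists2 u, jumps u & grid t q i < u <= grid t q i.+1) <->
  x (grid t q i) != x (grid t q i.+1).
Proof.
move=> iq; split=> [[u ju iui]|].
  have [ui ->] := cell_jump iq ju iui; apply/eqP => E.
  by case: ju => _; apply; rewrite -E.
move=> /eqP ne; apply: contrapT => nj; apply: ne; apply/esym; apply: path_constant.
- exact: grid_ge0.
- by rewrite grid_le.
- by rewrite -[leRHS](grid_end t q) grid_le.
- by move=> u ui ju; apply: nj; exists u.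
Qed.

(** A transition time is sent to the index of its cell, [(grid_index t q u).-1] because [grid_index]
    gives the right end. Separation makes this map injective, and [cell_changeP] with [cell_jump]
    identifies its image with the counted cells. *)
Lemma step_count_transition a b : a != b ->
  step_count q a b = transition_count x t a b.
Proof.
move=> ab; rewrite /transition_count -/(transitions a b).
have finab : finite_set (transitions a b).
  exact: sub_finite_set (transitions_jumps ab) fin.
rewrite /step_count -size_filter.
rewrite -(size_map (fun u => (grid_index t q u).-1) (enum_fset (fset_set _))).
have inT u : u \in enum_fset (fset_set (transitions a b)) -> transitions a b u.
  by rewrite in_fset_set// inE.
apply/perm_size/uniq_perm.
- by rewrite filter_uniq// iota_uniq.
- rewrite map_inj_in_uniq ?fset_uniq// => u v /inT Tu /inT Tv.
  have [i iq /[dup] iui /(grid_index_cell t0) ->] := grid_cellP t0 q Tu.1.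
  have [k kq /[dup] kvk /(grid_index_cell t0) ->] := grid_cellP t0 q Tv.1.
  move=> /= ik; subst k.
  have ju := transitions_jumps ab Tu; have jv := transitions_jumps ab Tv.
  move: iui kvk; rewrite !gridS => /andP[iu ui] /andP[iv vi].
  by have [uv|vu|//] := ltgtP u v; [have := sep ju jv uv|have := sep jv ju vu]; lra.
move=> i; rewrite mem_filter mem_iota add0n /=; apply/andP/mapP.
- move=> [/eqP[ia ib] iq]; have := (cell_changeP iq).2.
  rewrite ia ib => /(_ ab)[u ju iui]; exists u; last by rewrite (grid_index_cell t0 iui).
  have [ul ur] := cell_jump iq ju iui.
  rewrite in_fset_set// inE; split; first by case: ju.
  by rewrite -ur ib -ia.
- move=> [u /inT Tu ->]; have [k kq /[dup] kuk /(grid_index_cell t0) ->] := grid_cellP t0 q Tu.1.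
  rewrite /= kq; split => //.
  have [ul ->] := cell_jump kq (transitions_jumps ab Tu) kuk.
  have [_ [ua ->]] := Tu.
  have H : \forall v \near u^'-, x v = a /\ x v = x (grid t q k) by exact: filterI.
  by have [v [va vu]] := @filter_ex _ _ (at_left_proper_filter u) _ H; rewrite -va vu.
Qed.

Lemma grid_changes_le_jumps : (grid_changes q (2 ^ q) <= #|` fset_set jumps|)%N.
Proof.
rewrite /grid_changes -size_filter.
rewrite -(size_map (fun u => (grid_index t q u).-1) (enum_fset _)).
apply: uniq_leq_size; first by rewrite filter_uniq// iota_uniq.
move=> i; rewrite mem_filter mem_iota add0n /= => /andP[ch iq].
have [u ju iui] := (cell_changeP iq).2 ch.
apply/mapP; exists u; first by rewrite in_fset_set// inE.
by rewrite (grid_index_cell t0 iui).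
Qed.

End separated.

Lemma cells_measure q (p : pred nat) :
  lebesgue_measure (\big[setU/set0]_(i < 2 ^ q)
    (if p i then `]grid t q i, grid t q i.+1]%classic else set0)) =
  ((count p (iota 0 (2 ^ q)))%:R * mesh t q)%:E.
Proof.
set F := fun i : nat => if p i then `]grid t q i, grid t q i.+1]%classic else set0.
have mF i : measurable (F i) by rewrite /F; case: ifP.
rewrite (@measure_bigsetU _ _ _ (@lebesgue_measure R) F)//; last first.
  apply/trivIsetP => i k _ _ ik; rewrite /F; case: ifP => _; last by rewrite set0I.
  case: ifP => _; last by rewrite setI0.
  apply/seteqP; split => // u []; rewrite /= !in_itv/=.
  move=> /(grid_index_cell t0) Ei /(grid_index_cell t0); rewrite Ei => -[].
  by move/eqP; rewrite (negbTE ik).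
transitivity (\sum_(i < 2 ^ q) ((p i)%:R * mesh t q)%:E)%E.
  apply: eq_bigr => i _; rewrite /F; case: ifP => _; last by rewrite measure0 mul0r.
  rewrite -[LHS]/(lebesgue_measure `]grid t q i, grid t q i.+1]%classic).
  by rewrite lebesgue_measure_itv/= lte_fin (grid_lt t0) leqnn -EFinD gridS addrAC subrr add0r mul1r.
rewrite sumEFin -mulr_suml; congr (_ * _)%:E.
rewrite -sum1_count natr_sum [RHS]big_mkcond/=.
rewrite -(big_mkord xpredT (fun i => (p i)%:R : R)) /index_iota subn0.
by apply: eq_bigr => i _; case: (p i).
Qed.

(** Away from the jumps and the two end times the path is locally constant, so a point of the set is
    interior. The set is thus its interior together with finitely many points. *)
Lemma measurable_occupied a : measurable [set u : R | 0 <= u <= t /\ x u = a].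
Proof.
set S := (X in measurable X).
pose Z := jumps `|` [set 0; t].
have -> : S = S° `|` (S `&` Z).
  apply/seteqP; split=> [u Su|u [/interior_subset//|[]//]].
  have [Zu|nZ] := pselect (Z u); [by right|left].
  have [/andP[u0 ut] xu] := Su.
  have u0' : 0 < u.
    by rewrite lt_neqAle u0 andbT; apply/eqP => E; apply: nZ; right; left.
  have ut' : u < t.
    by rewrite lt_neqAle ut andbT; apply/eqP => E; apply: nZ; right; right.
  have : \forall v \near u^'-, x v = x u.
    by apply: contrapT => nu; apply: nZ; left; split => //; rewrite u0'.
  move=> /near_path_left[e e0 He].
  have [e' e'0 He'] := near_path_right u0.
  pose m := Num.min (Num.min e e') (Num.min u (t - u)).
  have m0 : 0 < m by rewrite /m !lt_min e0 e'0 u0' subr_gt0.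
  have [[me me'] [mu mt]] : (m <= e /\ m <= e') /\ (m <= u /\ m <= t - u).
    by rewrite /m !ge_min !lexx ?orbT.
  exists m => //= v /=; rewrite ltr_distlC => /andP[mv vm].
  split; first by apply/andP; split; lra.
  rewrite -xu; have [vu|uv] := ltP v u; first by apply: He; apply/andP; split; lra.
  by apply: He'; apply/andP; split; lra.
apply: measurableU.
  by apply: open_measurable; exact: open_interior.
apply: countable_measurable; first by move=> r; exact: measurable_set1.
apply: finite_set_countable; apply: finite_setIr.
by rewrite finite_setU; split => //; exact: finite_set2.
Qed.

(** Cells with both ends in [a] contain no jump and lie in the occupied set. They cover it, up to
    the point 0, once the changing cells are added; there are at most [K] of these, so the error is
    at most [K] meshes. *)
Lemma cvg_occupation_time a :
  (step_count q a a)%:R * mesh t q @[q --> \oo] --> occupation_time x t a.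
Proof.
rewrite /occupation_time; set S := [set u | _].
have mS : measurable S := measurable_occupied a.
pose K := #|` fset_set jumps|.
have H : \forall q \near \oo,
    (((step_count q a a)%:R * mesh t q)%:E <= lebesgue_measure S /\
     lebesgue_measure S <= ((step_count q a a + K)%:R * mesh t q)%:E)%E.
  apply: filterS near_separating => q sep.
  pose paa i := (x (grid t q i), x (grid t q i.+1)) == (a, a).
  pose pch i := x (grid t q i) != x (grid t q i.+1).
  pose cells (p : pred nat) := \big[setU/set0]_(i < 2 ^ q)
    (if p i then `]grid t q i, grid t q i.+1]%classic else set0).
  have cellsP p u : cells p u <->
      exists2 i, (i < 2 ^ q)%N & p i /\ grid t q i < u <= grid t q i.+1.
    rewrite /cells -(bigcup_mkord (2 ^ q)
      (fun i => if p i then `]grid t q i, grid t q i.+1]%classic else set0)).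
    split=> -[i /= iq]; last by move=> [pi iui]; exists i => //; rewrite pi /= in_itv.
    by case: ifP => // pi; rewrite /= in_itv/= => iui; exists i.
  have mcells p : measurable (cells p).
    by apply: bigsetU_measurable => i _; case: ifP.
  have cell_const i u : (i < 2 ^ q)%N -> grid t q i < u <= grid t q i.+1 ->
      x (grid t q i) = x (grid t q i.+1) -> x u = x (grid t q i).
    move=> iq /andP[iu ui] E; apply: path_constant.
    - exact: grid_ge0.
    - exact: ltW.
    - by rewrite (le_trans ui)// -[leRHS](grid_end t q) grid_le.
    - move=> w /andP[iw wu] jw; have := (cell_changeP sep iq).1.
      rewrite E eqxx => /(_ _)/negP; apply => //; exists w => //.
      by rewrite iw (le_trans wu).
  split.
    rewrite -cells_measure; apply: le_measure; rewrite ?inE//; first exact: (mcells paa).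
    move=> u /(cellsP paa)[i iq [/eqP[ia ib]]] /[dup] iui /andP[iu ui]; split.
      rewrite (le_trans (grid_ge0 t0 q i) (ltW iu)) (le_trans ui)//.
      by rewrite -[leRHS](grid_end t q) grid_le.
    by rewrite (cell_const i)// ia ib.
  (* The cells are open on the left, so time 0 belongs to none of them and has to be added by
     hand. *)
  apply: (@le_trans _ _ (lebesgue_measure (cells (predU paa pch) `|` [set 0]))).
    have mcU : measurable (cells (predU paa pch) `|` [set 0]).
      by apply: measurableU; [exact: mcells|exact: measurable_set1].
    apply: le_measure; rewrite ?inE//.
    move=> u [/andP[u0 ut] xu].
    move: u0; rewrite le_eqVlt => /predU1P[<-|u0]; [by right|left].
    have [i iq iui] : exists2 i, (i < 2 ^ q)%N & grid t q i < u <= grid t q i.+1.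
      by apply: grid_cellP => //; rewrite u0.
    apply/cellsP; exists i => //; split => //; apply/orP; rewrite /pch/=.
    have [E|] := eqVneq (x (grid t q i)) (x (grid t q i.+1)); [left|by right].
    by rewrite /paa -E -(cell_const i u)// xu.
  have U2 := measureU2 (@lebesgue_measure R) (mcells (predU paa pch)) (measurable_set1 (0:R)).
  apply: (le_trans U2).
  rewrite -[leLHS]/(lebesgue_measure (cells (predU paa pch)) + lebesgue_measure [set 0%R])%E.
  rewrite lebesgue_measure_set1 adde0 cells_measure lee_fin.
  rewrite ler_pM2r ?mesh_gt0// ler_nat.
  apply: (@leq_trans (count paa (iota 0 (2 ^ q)) + count pch (iota 0 (2 ^ q)))).
    by rewrite -count_predUI leq_addr.
  by rewrite leq_add2l; exact: grid_changes_le_jumps.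
apply: (@squeeze_cvgr _ _ _ _
   (fun q => occupation_time x t a - K%:R * mesh t q) (fun q => occupation_time x t a)).
- apply: filterS H => q [Hl Hu].
  have Sfin : lebesgue_measure S \is a fin_num.
    by rewrite ge0_fin_numE// (le_lt_trans Hu)// ltry.
  rewrite /occupation_time -/S; move: Hl Hu; rewrite -(fineK Sfin) !lee_fin => Hl Hu.
  by rewrite Hl andbT lerBlDr -mulrDl -natrD.
- rewrite -[X in _ --> X]subr0; apply: cvgB; first exact: cvg_cst.
  rewrite -[X in _ --> X](mulr0 K%:R); apply: cvgM; first exact: cvg_cst.
  exact: cvg_mesh.
- exact: cvg_cst.
Qed.

End right_continuous_path.

(** * Convergence of the grid likelihood *)

Lemma prod_count (R : comNzRingType) (I : Type) (J : finType) (k : I -> J)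
    (f : J -> R) (s : seq I) :
  \prod_(i <- s) f (k i) = \prod_c f c ^+ count (fun i => k i == c) s.
Proof.
elim: s => [|i s IH]; first by rewrite big_nil big1// => c _; rewrite expr0.
rewrite big_cons IH; under [RHS]eq_bigr => c _ do rewrite /= exprD.
rewrite big_split/=; congr (_ * _); rewrite (bigD1 (k i))//= eqxx expr1.
by rewrite big1 ?mulr1// => c; rewrite eq_sym => /negbTE ->; rewrite expr0.
Qed.

Definition grid_weight (R : realType) (n : nat) (Q : 'M[R]_n.+1)
    (x : R -> 'I_n.+1) (t : R) (q : nat) : R :=
  \prod_(i <- iota 0 (2 ^ q))
    expmx (mesh t q *: Q) (x (grid t q i)) (x (grid t q i.+1)).

(** This normalisation depends on the path alone and not on the regime, so it cancels in the
    posteriors. *)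
Definition jump_scale (R : realType) (n : nat) (x : R -> 'I_n.+1) (t : R)
    (q : nat) : R :=
  \prod_a \prod_(b | b != a) mesh t q ^+ transition_count x t a b.

Lemma jump_scale_gt0 (R : realType) (n : nat) (x : R -> 'I_n.+1) (t : R) q :
  0 < t -> 0 < jump_scale x t q.
Proof.
move=> t0; apply: prodr_gt0 => a _; apply: prodr_gt0 => b _.
by rewrite exprn_gt0// mesh_gt0.
Qed.

Lemma cvg_grid_weight (R : realType) (n : nat) (Q : 'M[R]_n.+1)
    (x : R -> 'I_n.+1) (t : R) : 0 < t ->
  (forall s, 0 <= s -> \forall u \near s^'+, x u = x s) ->
  finite_set (jumps x t) ->
  grid_weight Q x t q / jump_scale x t q @[q --> \oo] --> path_likelihood Q x t.
Proof.
move=> t0 rc fin.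
pose e q := expmx (mesh t q *: Q).
have H : \prod_a (e q a a ^+ step_count x t q a a *
    \prod_(b | b != a) ((e q a b / mesh t q) ^+ transition_count x t a b))
    @[q --> \oo] --> path_likelihood Q x t.
  rewrite /path_likelihood; apply: (cvg_big (@mul_continuous R)) => a _; apply: cvgM.
    rewrite opprK; apply: cvg_expmx_diag_exp.
    - by move=> q; exact: mesh_gt0.
    - exact: cvg_mesh.
    - exact: cvg_occupation_time.
  apply: (cvg_big (@mul_continuous R)) => b ba;
  have := @cvg_expmx_slope R n Q (mesh t) (mesh_gt0 t0) (cvg_mesh t) a b.
  rewrite eq_sym in ba.
  rewrite (negbTE ba); under eq_fun do rewrite subr0.
  move=> H; apply: (@cvg_comp _ _ _ _
    (fun y : R => y ^+ transition_count x t a b) _ _ _ H).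
  exact: exprn_continuous.
apply: cvg_trans H; apply: near_eq_cvg.
(* On a separating grid the off-diagonal step counts are already the transition counts, so the
   grouped product equals the normalised grid weight exactly. *)
have := near_separating fin; apply: filterS => q sep.
have -> : grid_weight Q x t q = \prod_a \prod_b e q a b ^+ step_count x t q a b.
  rewrite /grid_weight (prod_count (fun i => (x (grid t q i), x (grid t q i.+1)))
    (fun c => e q c.1 c.2)).
  by rewrite pair_bigA; apply: eq_bigr => -[a b] _.
rewrite /jump_scale -prodf_div; apply: eq_bigr => a _.
rewrite [X in _ = X / _](bigD1 a)//= -mulrA; congr (_ * _).
rewrite -prodf_div; apply: eq_bigr => b ba.
rewrite expr_div_n step_count_transition// 1?eq_sym//.
Qed.

(** * Conditional probabilities and densities *)

Section finite_fibres.
Context (R : realType) (d : measure_display) (T : measurableType d).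
Variables (J : finType) (K : T -> J).
Hypothesis mK : forall c, measurable [set w | K w = c].

Lemma ge0_integral_fibres (mu : {measure set T -> \bar R}) (A : set T)
    (f : T -> \bar R) :
  measurable A -> measurable_fun A f -> (forall w, A w -> 0 <= f w)%E ->
  (\int[mu]_(w in A) f w = \sum_c \int[mu]_(w in A `&` [set w | K w = c]) f w)%E.
Proof.
move=> mA mf f0.
have AE : A = \big[setU/set0]_(c <- enum J) (A `&` [set w | K w = c]).
  rewrite -bigcup_seq; apply/seteqP; split=> [w Aw|w [c _ []//]].
  by exists (K w) => //=; rewrite mem_enum.
rewrite {1}AE ge0_integral_bigsetU//.
- by rewrite big_enum.
- by move=> c; exact: measurableI.
- exact: enum_uniq.
- by move=> c c' _ _ [w [[_ <-] [_ <-]]].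
- by rewrite -AE.
- by rewrite -AE.
Qed.

Lemma measure_fibres (mu : {measure set T -> \bar R}) (A : set T) :
  measurable A -> mu A = (\sum_c mu (A `&` [set w | K w = c]))%E.
Proof.
move=> mA; have := @ge0_integral_fibres mu A (cst 1%E) mA.
rewrite integral_cst// mul1e => -> //; apply: eq_bigr => c _.
by rewrite integral_cst ?mul1e//; exact: measurableI.
Qed.

(** The preimage is a finite union of fibres, whatever [U] is. A general [G] lets the lemma serve
    the ambient sigma-algebra as well as that of the past. *)
Lemma finite_fibres_preimage (G : set_system T) (Y : Type) (h : J -> Y)
    (U : set Y) : sigma_algebra setT G ->
  (forall c, G [set w | K w = c]) -> G ((h \o K) @^-1` U).
Proof.
move=> [G0 _ GU] GK.
(* Closure of [G] concerns sequences, so the finite union is indexed by positions in [enum J] and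
   padded with the empty set. *)
rewrite [X in G X](_ : _ = \bigcup_i
    oapp (fun c => if `[< U (h c) >] then [set w | K w = c] else set0) set0
      (onth (enum J) i)).
  by apply: GU => i; case: onth => //= c; case: ifP.
apply/seteqP; split=> [w Uw|w [i _]] /=.
  exists (index (K w) (enum J)) => //.
  rewrite (_ : onth _ _ = Some (K w)); last first.
    by rewrite onthE (nth_map (K w)) ?index_mem ?mem_enum// nth_index ?mem_enum.
  by rewrite /= asboolT.
case: onth => //= c; case: asboolP => // Uc Kw; have Kc : K w = c by []; by rewrite Kc.
Qed.

End finite_fibres.

Section conditional_probability.
Context (R : realType) (d : measure_display) (T : measurableType d).
Variable P : probability T R.

(** The value 0 given to [cprob] on a null [B] is harmless, since the intersection is then null as
    well. *)
Lemma cprobM (A B : set T) : measurable A -> measurable B ->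
  ((cprob P A B)%:E * P B = P (A `&` B))%E.
Proof.
move=> mA mB; have mAB : measurable (A `&` B) := measurableI _ _ mA mB.
have PA : P (A `&` B) \is a fin_num by exact: fin_num_measure.
have PB : P B \is a fin_num by exact: fin_num_measure.
rewrite /cprob; have [PB0|PB0] := eqVneq (P B) 0%E.
  rewrite PB0 mule0; apply/esym/eqP; rewrite -measure_le0.
  by rewrite -PB0; apply: le_measure; rewrite ?inE//; exact: subIsetr.
by rewrite -{2}(fineK PB) -EFinM divfK ?fineK// fine_eq0.
Qed.

Lemma cprob_itv (A B : set T) : measurable A -> measurable B ->
  0 <= cprob P A B <= 1.
Proof.
move=> mA mB; have mAB : measurable (A `&` B) := measurableI _ _ mA mB.
rewrite /cprob divr_ge0 ?fine_ge0//=.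
have [PB0|PB0] := eqVneq (fine (P B)) 0; first by rewrite PB0 invr0 mulr0.
rewrite ler_pdivrMr ?mul1r; last by rewrite lt_neqAle eq_sym PB0 fine_ge0.
by apply: fine_le; rewrite ?fin_num_measure//; apply: le_measure; rewrite ?inE//; exact: subIsetr.
Qed.

(** Given a finite-valued observation [K], the conditional probability is constant on each fibre, so
    the identity is a sum of [cprobM] over fibres. It is the exact Bayes formula used on every
    grid. *)
Lemma integral_cprob_fibres (J : finType) (K : T -> J) (C : pred J)
    (E B : set T) :
  (forall c, measurable [set w | K w = c]) -> measurable E -> measurable B ->
  (P (E `&` ([set w | C (K w)] `&` B)) = \int[P]_(w in [set w | C (K w)] `&` B)
    (cprob P E ([set w' | K w' = K w] `&` B))%:E)%E.
Proof.
move=> mK mE mB; pose v c := cprob P E ([set w' | K w' = c] `&` B).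
have preK Y (h : J -> Y) U : measurable ((h \o K) @^-1` U).
  exact: (finite_fibres_preimage _ _ (sigma_algebra_measurable T) mK).
have mC : measurable [set w | C (K w)] by exact: (preK _ C (fun b => b)).
have mD : measurable ([set w | C (K w)] `&` B) by exact: measurableI.
rewrite (measure_fibres mK P (measurableI _ _ mE mD)) (ge0_integral_fibres mK)//.
- apply: eq_bigr => c _.
  have [Cc|nCc] := boolP (C c); last first.
    have D0 : [set w | C (K w)] `&` B `&` [set w | K w = c] = set0.
      by rewrite -subset0 => w [[/=+ _] Kw]; rewrite Kw (negbTE nCc).
    by rewrite -(setIA E) D0 setI0 measure0 integral_set0.
  have DE : [set w | C (K w)] `&` B `&` [set w | K w = c] = [set w | K w = c] `&` B.
    apply/seteqP; split=> [w [[_ Bw] Kw]|w [Kw Bw]]; first by split.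
    by split => //; split => //=; rewrite Kw.
  rewrite -(setIA E) DE (eq_integral (cst (v c)%:E)); last first.
    by move=> w; rewrite inE => -[/= -> _].
  by rewrite integral_cst ?cprobM//; exact: measurableI.
- apply: measurable_funTS => _ U mU; rewrite setTI.
  by have := preK _ (fun c => (v c)%:E) U.
- by move=> w _; rewrite lee_fin; have /andP[] := cprob_itv mE (measurableI _ _ (mK (K w)) mB).
Qed.

(** The tail intersections increase to the set in question, and each is contained in some [A q] with
    [q] beyond the threshold of the bound. *)
Lemma probability_liminf_le (A : (set T)^nat) (c : \bar R) :
  (forall q, measurable (A q)) -> (\forall q \near \oo, P (A q) <= c)%E ->
  (P (\bigcup_N \bigcap_(q in [set q | (N <= q)%N]) A q) <= c)%E.
Proof.
move=> mA [N0 _ Ac]; pose F N := \bigcap_(q in [set q | (N <= q)%N]) A q.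
have mF N : measurable (F N) by apply: bigcap_measurable => //; exists N => /=.
have H : (P \o F) x @[x --> \oo] --> P (\bigcup_N F N).
  apply: nondecreasing_cvg_mu => //; first exact: bigcupT_measurable.
  by move=> i k ik; apply/subsetPset => w Fw q /= kq; apply: Fw => /=; exact: leq_trans kq.
rewrite -(cvg_lim _ H)//; apply: lime_le; first by apply: cvgP H.
apply: nearW => N /=; apply: (@le_trans _ _ (P (A (maxn N N0)))).
  by apply: le_measure; rewrite ?inE// => w; apply => /=; exact: leq_maxl.
by apply: Ac => /=; exact: leq_maxr.
Qed.

End conditional_probability.

(** * Integration against a density *)

Section density.
Local Open Scope ereal_scope.
Context (R : realType) (d : measure_display) (Z : measurableType d).
Variables (mu nu : {measure set Z -> \bar R}) (f : Z -> R).
Hypotheses (mf : measurable_fun setT f) (f0 : forall z, (0 <= f z)%R).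
Hypothesis density : forall V, measurable V -> mu V = \int[nu]_(z in V) (f z)%:E.

Import HBNNSimple.

Let mEf D : measurable_fun D (EFin \o f).
Proof. by apply: measurable_funTS; exact/measurable_EFinP. Qed.

(** Monotone convergence on both sides reduces [h] to simple functions, linearity reduces these to
    indicators, and for an indicator the identity is the hypothesis [density]. *)
Lemma ge0_integral_density (h : Z -> \bar R) (D : set Z) :
  measurable D -> measurable_fun D h -> (forall z, D z -> 0 <= h z) ->
  \int[mu]_(z in D) h z = \int[nu]_(z in D) (h z * (f z)%:E).
Proof.
move=> mD mh h0; pose a := nnsfun_approx mD mh.
have ah z : D z -> (EFin \o a k) z @[k --> \oo] --> h z.
  by move=> Dz; exact: cvg_nnsfun_approx.
have -> : \int[mu]_(z in D) h z = lim (\int[mu]_(z in D) (EFin \o a k) z @[k --> \oo]).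
  rewrite -monotone_convergence//.
  - by apply: eq_integral => z /[!inE] Dz; apply/esym/cvg_lim => //; exact: ah.
  - by move=> k; apply: measurable_funTS; exact/measurable_EFinP/measurable_funP.
  - by move=> k z _; rewrite lee_fin.
  - by move=> z _ k l kl; rewrite lee_fin; exact/lefP/nd_nnsfun_approx.
have -> : \int[nu]_(z in D) (h z * (f z)%:E) =
    lim (\int[nu]_(z in D) ((a k z)%:E * (f z)%:E) @[k --> \oo]).
  rewrite -monotone_convergence//.
  - apply: eq_integral => z /[!inE] Dz; apply/esym/cvg_lim => //.
    by apply: cvgeZr => //; exact: ah.
  - move=> k; apply: emeasurable_funM => //.
    by apply: measurable_funTS; exact/measurable_EFinP/measurable_funP.
  - by move=> k z _; rewrite -EFinM lee_fin mulr_ge0.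
  - move=> z _ k l kl; rewrite lee_wpmul2r ?lee_fin//.
    exact/lefP/nd_nnsfun_approx.
suff suf k : \int[mu]_(z in D) (EFin \o a k) z =
    \int[nu]_(z in D) ((a k z)%:E * (f z)%:E).
  by under eq_fun do rewrite suf.
have mr r : measurable (a k @^-1` [set r]) by [].
transitivity (\int[mu]_(z in D)
   (\sum_(y \in range (a k)) (y * \1_(a k @^-1` [set y]) z)%:E)).
  by apply: eq_integral => z _; rewrite /= fimfunE -fsumEFin.
rewrite ge0_integral_fsum//; last 2 first.
- by move=> r; apply: measurable_funTS; apply/measurable_EFinP; exact: measurable_funM.
- by move=> r z _; exact: nnfun_muleindic_ge0.
transitivity (\int[nu]_(z in D)
   (\sum_(y \in range (a k)) (y * \1_(a k @^-1` [set y]) z)%:E * (f z)%:E)); last first.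
  apply: eq_integral => z _; rewrite -ge0_mule_fsuml; last first.
    by move=> r; exact: nnfun_muleindic_ge0.
  by rewrite fsumEFin// -fimfunE.
rewrite ge0_integral_fsum//; last 2 first.
- move=> r; apply: emeasurable_funM => //.
  by apply: measurable_funTS; apply/measurable_EFinP; exact: measurable_funM.
- by move=> r z _; rewrite mule_ge0 ?lee_fin//; exact: nnfun_muleindic_ge0.
apply: eq_fsbigr => r; rewrite inE => -[z0 _ rE].
have r0 : (0 <= r)%R by rewrite -rE.
under eq_integral do rewrite EFinM.
rewrite ge0_integralZl//; last first.
  by apply: measurable_funTS; exact/measurable_EFinP.
under [in RHS]eq_integral do rewrite EFinM -muleA.
rewrite [RHS]ge0_integralZl//; first last.
- by move=> z _; rewrite mule_ge0 ?lee_fin.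
- apply: emeasurable_funM => //.
  by apply: measurable_funTS; exact/measurable_EFinP.
congr (_ * _); rewrite integral_indic// density; last exact: measurableI.
rewrite setIC integral_mkcondr; apply: eq_integral => z _.
by rewrite patchE indicE; case: ifP => _; rewrite ?mul1e ?mul0e.
Qed.

End density.

(** Continuity holds on the open complement of 0, and 0 is split off as a measurable singleton. *)
Lemma measurable_inv (R : realType) : measurable_fun [set: R] (fun x : R => x^-1).
Proof.
have -> : [set: R] = [set x | x != 0] `|` [set 0].
  apply/esym; rewrite -subTset => x _ /=.
  by have [->|x0] := eqVneq x 0; [right|left].
have op : open [set x : R | x != 0].
  rewrite (_ : [set x | _] = ~` [set 0]); first by rewrite openC; exact: closed_eq.
  by apply/seteqP; split=> x /= /eqP.
apply/measurable_funU => //; first exact: open_measurable.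
split; last exact: measurable_fun_set1.
apply: open_continuous_measurable_fun => // x; rewrite inE /= => x0.
exact: inv_continuous.
Qed.

Lemma regime_weightE (R : realType) (n m : nat) (pi0 : 'cV[R]_n.+1)
    (s : 'I_m -> 'rV[R]_n.+1) (L : 'I_m -> 'M[R]_n.+1) j k :
  regime_weight pi0 s L j k = \sum_i pi0 i 0 * s k 0 i * L k i j.
Proof.
rewrite /regime_weight -colE mxE [LHS]mxE; apply: eq_bigr => i _.
by rewrite mul_mx_diag !mxE.
Qed.

(** * Markov's inequality for the number of events that occur *)

Section markov_count.
Context (R : realType) (d : measure_display) (T : measurableType d).
Variables (P : probability T R) (p : nat -> T -> bool).
Hypothesis mp : forall i, measurable [set w | p i w].

Let total (N : nat) (w : T) : R := \sum_(i <- iota 0 N) \1_[set w | p i w] w.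

Let totalE N w : total N w = (count (p^~ w) (iota 0 N))%:R.
Proof.
rewrite /total -sum1_count natr_sum [RHS]big_mkcond; apply: eq_bigr => i _.
by rewrite indicE; case: ifPn => [pw|/negP pw]; [rewrite mem_set|rewrite memNset].
Qed.

Lemma measurable_count_ge (N M : nat) :
  measurable [set w | (M <= count (p^~ w) (iota 0 N))%N].
Proof.
have mtot : measurable_fun setT (total N).
  by apply: measurable_sum => i; exact: measurable_indic.
rewrite (_ : [set _ | _] = total N @^-1` `[M%:R, +oo[%classic).
  by rewrite -[X in measurable X]setTI; exact: (mtot measurableT _ (measurable_itv _)).
by apply/seteqP; split=> w; rewrite /= in_itv/= andbT totalE ler_nat.
Qed.

(** The count is a sum of indicators, so its expectation is the right-hand side, and it dominates
    [M] times the indicator of the event pointwise. *)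
Lemma markov_count (N M : nat) :
  (M%:R%:E * P [set w | (M <= count (p^~ w) (iota 0 N))%N] <=
   \sum_(i <- iota 0 N) P [set w | p i w])%E.
Proof.
set A := [set w | _]; have mA : measurable A by exact: measurable_count_ge.
rewrite (eq_bigr (fun i => \int[P]_w (\1_[set w | p i w] w)%:E))%E; last first.
  by move=> i _; rewrite integral_indic ?setIT.
rewrite -ge0_integral_sum//; last first.
  by move=> i; apply/measurable_EFinP; exact: measurable_indic.
apply: (@le_trans _ _ (\int[P]_w (M%:R * \1_A w)%:E)%E).
  under eq_integral do rewrite EFinM.
  rewrite ge0_integralZl//.
    by rewrite integral_indic ?setIT.
  by apply/measurable_EFinP; exact: measurable_indic.
apply: ge0_le_integral => //.
- apply/measurable_EFinP; apply: measurable_funM; first exact: measurable_cst.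
  exact: measurable_indic.
- under eq_fun do rewrite sumEFin.
  by apply/measurable_EFinP; apply: measurable_sum => i; exact: measurable_indic.
move=> w _; rewrite sumEFin lee_fin -/(total N w) totalE.
have [Aw|nAw] := pselect (A w); rewrite indicE.
  by rewrite mem_set// mulr1 ler_nat.
by rewrite memNset// mulr0.
Qed.

End markov_count.

Lemma integral_indicM (R : realType) (d : measure_display)
    (T : measurableType d) (mu : {measure set T -> \bar R}) (A B : set T)
    (h : T -> R) :
  (\int[mu]_(w in B) (\1_A w * h w)%:E = \int[mu]_(w in A `&` B) (h w)%:E)%E.
Proof.
rewrite setIC integral_mkcondr; apply: eq_integral => w _.
by rewrite patchE indicE; case: ifP => _; rewrite ?mul1r ?mul0r.
Qed.

Lemma bounded_convergence (R : realType) (d : measure_display)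
    (T : measurableType d) (P : probability T R) (B : set T)
    (F : nat -> T -> R) (f : T -> R) :
  measurable B -> (forall q, measurable_fun setT (F q)) ->
  measurable_fun setT f ->
  {ae P, forall w, B w -> F q w @[q --> \oo] --> f w} ->
  (forall q w, `|F q w| <= 1) ->
  (\int[P]_(w in B) (F q w)%:E @[q --> \oo] --> \int[P]_(w in B) (f w)%:E)%E.
Proof.
move=> mB mF mf Ff F1.
have [//| | | | |_ _] := @dominated_convergence _ _ _ P B mB
  (fun q => EFin \o F q) (EFin \o f) (EFin \o cst 1).
- by move=> q; apply: measurable_funTS; exact/measurable_EFinP.
- by apply: measurable_funTS; exact/measurable_EFinP.
- by apply: filterS Ff => w Fw Bw; apply: cvg_EFin; [exact: nearW|exact: Fw].
- exact: finite_measure_integrable_cst.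
- by apply: nearW => w q _ /=; rewrite lee_fin.
- exact.
Qed.

(** * The law of the mixture *)

Section mixture_law.
Context (R : realType) (n m : nat) (d : measure_display)
  (T : measurableType d) (P : probability T R).
Variables (Q : 'I_m -> 'M[R]_n.+1) (Xk : 'I_m -> R -> T -> 'I_n.+1)
  (phi : T -> 'I_m) (pi0 : 'cV[R]_n.+1) (s : 'I_m -> 'rV[R]_n.+1).
Hypotheses (hphi : forall k, measurable [set w | phi w = k])
  (hX : forall k,
     markov_jump (cond_law P [set w | phi w = k]) (Q k) (Xk k))
  (hpi : forall i, P [set w | mixture phi Xk 0 w = i] = (pi0 i 0)%:E)
  (hs : forall i k, P [set w | mixture phi Xk 0 w = i] != 0%E ->
     cprob P [set w | phi w = k] [set w | mixture phi Xk 0 w = i] = s k 0 i).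

Local Notation X := (mixture phi Xk).
Local Notation E k := [set w | phi w = k].

Definition cylinder (r : seq (R * 'I_n.+1)) : set T :=
  [set w | all (fun p => X p.1 w == p.2) r].

Lemma measurable_state u i : 0 <= u -> measurable [set w | X u w = i].
Proof.
move=> u0; rewrite (_ : [set _ | _] = \bigcup_(k in [set: 'I_m]) (E k `&` [set w | Xk k u w = i])).
  apply: fin_bigcup_measurable; first exact: finite_finset.
  by move=> k _; apply: measurableI => //; have [mX _ _] := hX k; exact: mX.
apply/seteqP; split=> [w Xw|w [k _ [/= <-]]] //.
by exists (phi w).
Qed.

Lemma measurable_cylinder r : all (fun p => 0 <= p.1) r -> measurable (cylinder r).
Proof.
elim: r => [_|[u i] r IH /= /andP[u0 /IH mr]].
  by rewrite (_ : cylinder _ = setT)//; apply/seteqP.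
rewrite (_ : cylinder _ = [set w | X u w = i] `&` cylinder r).
  by apply: measurableI => //; exact: measurable_state.
rewrite /cylinder; apply/seteqP; split=> [w /= /andP[/eqP Xw rw]|w /= [-> ->]].
  by split.
by rewrite eqxx.
Qed.

Lemma mixture_right_continuous w u : 0 <= u ->
  \forall v \near u^'+, X v w = X u w.
Proof. by move=> u0; have [_ + _] := hX (phi w); apply. Qed.

Lemma fine_cprob A B : measurable A -> measurable B ->
  cprob P A B * fine (P B) = fine (P (A `&` B)).
Proof.
by move=> mA mB; rewrite -cprobM// fineM// fin_num_measure.
Qed.

(** On [E k] the mixture is the process [Xk k], whose Markov property holds under the law
    conditioned on [E k]. Joint probabilities are compared so that null conditioning events are
    covered: both sides then vanish. *)
Lemma mixture_markov k r u h i j : 0 <= u -> 0 <= h ->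
  all (fun p => 0 <= p.1 < u) r ->
  fine (P (E k `&` (cylinder r `&` [set w | X u w = i] `&`
                    [set w | X (u + h) w = j]))) =
  fine (P (E k `&` (cylinder r `&` [set w | X u w = i]))) * expmx (h *: Q k) i j.
Proof.
move=> u0 h0 ru.
set B := cylinder r `&` _; set A := [set w | X (u + h) w = j].
have mB : measurable B.
  apply: measurableI; last exact: measurable_state.
  by apply: measurable_cylinder; apply: sub_all ru => p /andP[].
have mA : measurable A by apply: measurable_state; rewrite addr_ge0.
have mEB : measurable (E k `&` B) by exact: measurableI.
have [PEB0|PEB0] := eqVneq (P (E k `&` B)) 0%E.
  rewrite PEB0/= mul0r; have -> : P (E k `&` (B `&` A)) = 0%E; last by [].
  apply/eqP; rewrite -measure_le0 -PEB0; apply: le_measure; rewrite ?inE//.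
    by apply: measurableI => //; exact: measurableI.
  by move=> w [? []].
have PE0 : fine (P (E k)) != 0.
  rewrite fine_eq0 ?fin_num_measure//; apply: contra_neq PEB0 => PE0.
  apply/eqP; rewrite -measure_le0 -PE0; apply: le_measure; rewrite ?inE//.
have [_ _ /(_ r u h i j u0 h0 ru)/=] := hX k.
set B' := _ `&` _; set A' := [set w | _ = j].
have EB' : B' `&` E k = E k `&` B.
  rewrite setIC; apply/seteqP; split=> w [Ew [Cw Xw]]; split => //; split => //.
  - by move: Cw; rewrite /cylinder /=; apply: sub_all => p; rewrite /mixture Ew.
  - by rewrite /= /mixture Ew.
  - by move: Cw; rewrite /cylinder /=; apply: sub_all => p; rewrite /mixture Ew.
  - by move: Xw; rewrite /= /mixture Ew.
have EAB' : A' `&` B' `&` E k = E k `&` (B `&` A).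
  rewrite -setIA EB'; apply/seteqP; split=> [w [Aw [Ew Bw]]|w [Ew [Bw Aw]]].
    by split => //; split => //; rewrite /A /= /mixture Ew.
  by split => //; move: Aw; rewrite /A /= /mixture Ew.
rewrite /cond_law /cprob EB' EAB' => <-.
  have EB0 : fine (P (E k `&` B)) != 0 by rewrite fine_eq0 ?fin_num_measure.
  by rewrite /=; field; rewrite PE0.
by rewrite eqe mulf_neq0 ?invr_neq0// fine_eq0 ?fin_num_measure.
Qed.

(** For a state of initial probability 0, [hs] gives no information on [s k 0 i], but the factor
    [pi0 i 0] vanishes. *)
Lemma initial_law k i :
  fine (P (E k `&` [set w | X 0 w = i])) = pi0 i 0 * s k 0 i.
Proof.
have mX0 : measurable [set w | X 0 w = i] by exact: measurable_state.
rewrite -fine_cprob//.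
have [P0|P0] := eqVneq (P [set w | X 0 w = i]) 0%E.
  have : pi0 i 0 = 0 by apply: EFin_inj; rewrite -hpi.
  by move=> ->; rewrite P0 mulr0 mul0r.
by rewrite hs// hpi mulrC.
Qed.

Definition grid_cylinder (t : R) (q N : nat) (c : nat -> 'I_n.+1) : set T :=
  [set w | all (fun i => X (grid t q i) w == c i) (iota 0 N.+1)].

(** By induction on the number of steps: [mixture_markov] splits off the last sample, with the
    earlier samples as its record [r]. *)
Lemma grid_cylinder_law (t : R) (q N : nat) (c : nat -> 'I_n.+1) k : 0 < t ->
  fine (P (E k `&` grid_cylinder t q N c)) = pi0 (c 0%N) 0 * s k 0 (c 0%N) *
    \prod_(i <- iota 0 N) expmx (mesh t q *: Q k) (c i) (c i.+1).
Proof.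
move=> t0; elim: N => [|N IH].
  rewrite big_nil mulr1 -initial_law; congr (fine (P (_ `&` _))).
  apply/seteqP; split=> w; rewrite /grid_cylinder /= /grid mul0r andbT => /eqP//.
have iotaS k' : iota 0 k'.+1 = iota 0 k' ++ [:: k'] by rewrite -addn1 iotaD.
rewrite iotaS big_cat big_seq1 mulrA -IH.
pose r := [seq (grid t q i, c i) | i <- iota 0 N].
have rE N' c' : grid_cylinder t q N'.+1 c' =
    grid_cylinder t q N' c' `&` [set w | X (grid t q N'.+1) w = c' N'.+1].
  rewrite /grid_cylinder iotaS; move: (iota 0 N'.+1) => l.
  apply/seteqP; split=> w /=; rewrite all_cat /= andbT.
    by move=> /andP[? /eqP].
  by move=> [-> ->]; rewrite eqxx.
have rE' : grid_cylinder t q N c = cylinder r `&` [set w | X (grid t q N) w = c N].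
  rewrite /grid_cylinder /cylinder iotaS /r; move: (iota 0 N) => l.
  apply/seteqP; split=> w /=; rewrite all_cat all_map /= andbT.
    by move=> /andP[? /eqP].
  by move=> [-> ->]; rewrite eqxx.
rewrite rE rE' gridS mixture_markov//.
- exact: grid_ge0.
- exact/ltW/mesh_gt0.
- apply/allP => _ /mapP[i + ->]; rewrite mem_iota add0n /= => iN.
  by rewrite grid_ge0//= grid_lt.
Qed.

Lemma fine_regimes A : measurable A ->
  fine (P A) = \sum_k fine (P (E k `&` A)).
Proof.
move=> mA; have fin k : P (E k `&` A) \is a fin_num.
  by rewrite fin_num_measure//; exact: measurableI.
apply: EFin_inj; rewrite fineK ?fin_num_measure// (measure_fibres hphi P mA).
by rewrite -sumEFin; apply: eq_bigr => k _; rewrite setIC fineK.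
Qed.

Lemma fine_initial_states A : measurable A ->
  fine (P A) = \sum_i fine (P (A `&` [set w | X 0 w = i])).
Proof.
move=> mA; have mX0 i : measurable [set w | X 0 w = i] by exact: measurable_state.
have fin i : P (A `&` [set w | X 0 w = i]) \is a fin_num.
  by rewrite fin_num_measure//; exact: measurableI.
apply: EFin_inj; rewrite fineK ?fin_num_measure// (measure_fibres mX0 P mA).
by rewrite -sumEFin; apply: eq_bigr => i _; rewrite fineK.
Qed.

(** The common form of Bayes' formula for events: only the proportions between the regimes matter.
    The factor [c] and the free vector [pi'] allow a fixed initial state, where [pi0 i0 0]
    cancels. *)
Lemma cprob_bayes_update (pi' : 'cV[R]_n.+1) (L : 'I_m -> 'M[R]_n.+1) j k
    (c : R) (G : set T) : c != 0 -> measurable G ->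
  (forall l, fine (P (E l `&` G)) = c * regime_weight pi' s L j l) ->
  cprob P (E k) G = bayes_update pi' s L j k.
Proof.
move=> c0 mG H; rewrite /cprob /bayes_update (fine_regimes mG) H.
rewrite (eq_bigr _ (fun l _ => H l)) -mulr_sumr.
by rewrite invfM mulrACA divff// mul1r.
Qed.

Lemma event_likelihood_regime (t : R) j F l : 0 <= t -> measurable F ->
  fine (P (E l `&` (F `&` [set w | X t w = j]))) =
  regime_weight pi0 s (event_likelihood P phi X t F) j l.
Proof.
move=> t0 mF; rewrite regime_weightE fine_initial_states; last first.
  by apply: measurableI => //; apply: measurableI => //; exact: measurable_state.
apply: eq_bigr => i _; rewrite mxE -initial_law mulrC fine_cprob.
- by congr (fine (P _)); rewrite [E l `&` (F `&` _)]setIC -setIA.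
- by apply: measurableI => //; exact: measurable_state.
- by apply: measurableI => //; exact: measurable_state.
Qed.

Lemma transition_law k u h a b : 0 <= u -> 0 <= h ->
  fine (P (E k `&` ([set w | X u w = a] `&` [set w | X (u + h) w = b]))) =
  fine (P (E k `&` [set w | X u w = a])) * expmx (h *: Q k) a b.
Proof.
move=> u0 h0; have := @mixture_markov k [::] u h a b u0 h0 isT.
have -> : cylinder [::] = setT by apply/seteqP; split.
by rewrite setTI.
Qed.

Lemma state_regime t j l : 0 <= t ->
  fine (P (E l `&` [set w | X t w = j])) =
  regime_weight pi0 s (fun l => expmx (t *: Q l)) j l.
Proof.
move=> t0; rewrite regime_weightE fine_initial_states; last first.
  by apply: measurableI => //; exact: measurable_state.
apply: eq_bigr => i _; rewrite -setIA [X in _ `&` X]setIC -{1}(add0r t).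
by rewrite transition_law// initial_law.
Qed.

Lemma initial_state_regime t i0 j l : 0 <= t ->
  fine (P (E l `&` ([set w | X 0 w = i0] `&` [set w | X t w = j]))) =
  pi0 i0 0 * regime_weight (delta_mx i0 0) s (fun l => expmx (t *: Q l)) j l.
Proof.
move=> t0; rewrite regime_weightE -{1}(add0r t) transition_law// initial_law.
rewrite (bigD1 i0)//= mxE !eqxx mul1r big1 ?addr0 ?mulrA//.
by move=> i ii0; rewrite mxE (negbTE ii0) !mul0r.
Qed.

(** * Bayes' formula for information observed through a density *)

Section random_element_likelihood.
Variables (t : R) (j : 'I_n.+1) (k : 'I_m) (d' : measure_display)
  (Z : measurableType d') (Y : T -> Z) (nu : {measure set Z -> \bar R})
  (L : 'I_m -> Z -> 'M[R]_n.+1).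
Hypotheses (t0 : 0 <= t) (mY : measurable_fun setT Y)
  (LY : is_likelihood P phi X t Y nu L)
  (s0 : forall i k, 0 <= s k 0 i).

Local Notation weight l z := (regime_weight pi0 s (fun l => L l z) j l).
Local Notation B := [set w | X t w = j].

Let mB : measurable B. Proof. exact: measurable_state. Qed.

Let mYV V : measurable V -> measurable (Y @^-1` V).
Proof. by move=> mV; rewrite -[X in measurable X]setTI; exact: mY. Qed.

Let pi_ge0 i : 0 <= pi0 i 0.
Proof. by rewrite -lee_fin -hpi. Qed.

Let weight_ge0 l z : 0 <= weight l z.
Proof.
by rewrite regime_weightE; apply: sumr_ge0 => i _; rewrite !mulr_ge0//; have [_ + _] := LY; apply.
Qed.

Let measurable_weight l : measurable_fun setT (fun z => weight l z).
Proof.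
under eq_fun do rewrite regime_weightE.
apply: measurable_sum => i; apply: measurable_funM => //.
by have [+ _ _] := LY; apply.
Qed.

(** Averaging the likelihood over initial states gives the density of [Y] on the regime [l] with
    [X t w = j]. Null pairs (regime, initial state), on which [is_likelihood] is silent, have weight
    0 by [initial_law]. *)
Let integral_weight l V : measurable V ->
  (P (E l `&` (Y @^-1` V `&` B)) = \int[nu]_(z in V) (weight l z)%:E)%E.
Proof.
have [mL L0 LE] := LY => mV.
have mYB : measurable (Y @^-1` V `&` B) by apply: measurableI => //; exact: mYV.
have mEYB : measurable (E l `&` (Y @^-1` V `&` B)) by exact: measurableI.
under eq_integral do rewrite regime_weightE -sumEFin.
rewrite ge0_integral_sum//; last 2 first.
- move=> i; apply/measurable_EFinP; apply: measurable_funTS.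
  by apply: measurable_funM.
- by move=> i z _; rewrite lee_fin !mulr_ge0.
rewrite -[LHS]fineK ?fin_num_measure// fine_initial_states// -sumEFin.
apply: eq_bigr => i _; under eq_integral do rewrite EFinM.
rewrite ge0_integralZl//; last 3 first.
- by apply/measurable_EFinP; exact: measurable_funTS.
- by move=> z _; rewrite lee_fin.
- by rewrite lee_fin mulr_ge0.
have mX0 : measurable [set w | X 0 w = i] by exact: measurable_state.
have mEX : measurable (E l `&` [set w | X 0 w = i]) by exact: measurableI.
have -> : E l `&` (Y @^-1` V `&` B) `&` [set w | X 0 w = i] =
    Y @^-1` V `&` B `&` (E l `&` [set w | X 0 w = i]).
  by rewrite [E l `&` _]setIC -setIA.
rewrite -fine_cprob// -initial_law EFinM muleC.
have [P0|P0] := eqVneq (P (E l `&` [set w | X 0 w = i])) 0%E.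
  by rewrite P0 !mul0e.
by rewrite LE.
Qed.

(** The sum [f] of the weights is the density of the law of [Y] restricted to [B]. Integrating the
    ratio [g] against that law therefore restores the numerator, whose integral is the joint
    probability with [E k]. *)
Lemma random_element_bayes :
  is_cond_prob P (g_sigma_algebra_preimage Y) B (E k)
    (fun w => bayes_update pi0 s (fun l => L l (Y w)) j k).
Proof.
pose f z := \sum_l weight l z.
have f0 z : 0 <= f z by apply: sumr_ge0.
pose g z := bayes_update pi0 s (fun l => L l z) j k.
have gE z : g z = weight k z / f z by [].
have g01 z : 0 <= g z <= 1.
  rewrite gE divr_ge0//=; have [->|fz] := eqVneq (f z) 0.
    by rewrite invr0 mulr0.
  rewrite ler_pdivrMr ?mul1r; last by rewrite lt_neqAle eq_sym fz f0.
  by rewrite /f (bigD1 k)//= lerDl sumr_ge0.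
have mf : measurable_fun setT f by exact: measurable_sum.
have mg : measurable_fun setT g.
  apply: measurable_funM => //; apply: measurableT_comp => //.
  exact: measurable_inv.
have mgY : measurable_fun setT (g \o Y) by exact: measurableT_comp.
split.
- move=> U mU; exists (g @^-1` U); last by rewrite setTI.
  by rewrite -[X in measurable X]setTI; exact: mg.
- apply: (@le_integrable _ _ _ _ _ _ _ (EFin \o cst 1)) => //.
  + by apply/measurable_EFinP; exact: measurable_funTS.
  + move=> w _; rewrite /= lee_fin normr1.
    by have /andP[g0 g1] := g01 (Y w); rewrite ger0_norm.
  + exact: finite_measure_integrable_cst.
move=> _ [V mV <-]; rewrite setTI.
pose PB := mrestr P mB.
have density V' : measurable V' -> pushforward PB Y V' = (\int[nu]_(z in V') (f z)%:E)%E.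
  move=> mV'; rewrite /pushforward /PB /mrestr.
  under eq_integral do rewrite -sumEFin.
  rewrite ge0_integral_sum//; last 2 first.
  - by move=> l; apply/measurable_EFinP; exact: measurable_funTS.
  - by move=> l z _; rewrite lee_fin.
  have mYB : measurable (Y @^-1` V' `&` B) by apply: measurableI => //; exact: mYV.
  rewrite (measure_fibres hphi P mYB); apply: eq_bigr => l _.
  by rewrite [_ `&` E l]setIC; exact: integral_weight.
transitivity (\int[pushforward PB Y]_(z in V) (g z)%:E)%E.
  rewrite (ge0_integral_density mf f0 density)//; last 2 first.
  - by apply/measurable_EFinP; exact: measurable_funTS.
  - by move=> z _; rewrite lee_fin; have /andP[] := g01 z.
  rewrite integral_weight//; apply: eq_integral => z _; rewrite -EFinM gE.
  (* Where [f] vanishes the quotient is 0 by convention, and each weight vanishes as well because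
     all are nonnegative. *)
  have [fz|fz] := eqVneq (f z) 0; last by rewrite divfK.
  have := fz; rewrite /f => /eqP; rewrite psumr_eq0// => /allP/(_ k).
  by rewrite mem_index_enum => /(_ isT)/eqP ->; rewrite !mul0r.
rewrite ge0_integral_pushforward//; last 2 first.
- by apply/measurable_EFinP; exact: measurable_funTS.
- by move=> z _; rewrite lee_fin; have /andP[] := g01 z.
(* The restriction [PB] has the indicator of [B] as density with respect to [P]. *)
rewrite (@ge0_integral_density _ _ _ PB P (\1_B))//.
- rewrite [RHS]integral_mkcondr; apply: eq_integral => w _.
  by rewrite patchE indicE /=; case: ifP => _; rewrite ?mule1 ?mule0.
- by move=> V' mV'; rewrite /PB /mrestr integral_indic// setIC.
- exact: mYV.
- by apply: measurable_funTS; exact/measurable_EFinP.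
- by move=> w _; rewrite lee_fin; have /andP[] := g01 (Y w).
Qed.

End random_element_likelihood.

(** * Full information *)

Section full_information.
Variables (t : R) (j : 'I_n.+1) (k : 'I_m).
Hypotheses (t0 : 0 < t)
  (Q0 : forall l a b, a != b -> 0 <= Q l a b)
  (s0 : forall i l, 0 <= s l 0 i).

Local Notation B := [set w | X t w = j].
Local Notation path w := (X ^~ w).

Let mB : measurable B. Proof. exact/measurable_state/ltW. Qed.

(** There are finitely many pairs (regime, initial state), and by [initial_law] those of weight 0
    are null. This keeps the common factors of the posteriors away from 0. *)
Lemma ae_initial :
  {ae P, forall w, pi0 (X 0 w) 0 * s (phi w) 0 (X 0 w) != 0}.
Proof.
have H : \forall w \near almost_everywhere P, forall c : 'I_m * 'I_n.+1,
    phi w = c.1 -> X 0 w = c.2 -> pi0 c.2 0 * s c.1 0 c.2 != 0.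
  apply: filter_forall => -[l i] /=.
  have [P0|P0] := eqVneq (pi0 i 0 * s l 0 i) 0; last exact: nearW.
  have mEX : measurable (E l `&` [set w | X 0 w = i]).
    by apply: measurableI => //; exact: measurable_state.
  exists (E l `&` [set w | X 0 w = i]); split => //.
    by apply/eqP; rewrite -fine_eq0 ?fin_num_measure// initial_law P0.
  by move=> w /= H; apply: contrapT => nH; apply: H => Ew Xw; case: nH.
by apply: filterS H => w Hw; exact: (Hw (phi w, X 0 w)).
Qed.

(** The linear and quadratic parts stay separate: the former gives a bound of order [mesh] for any
    change, and when the rate is 0 only the latter remains. *)
Lemma step_prob_le l : exists2 C : R, 0 <= C & \forall q \near \oo,
  forall u a b, 0 <= u -> a != b ->
  fine (P (E l `&` ([set w | X u w = a] `&` [set w | X (u + mesh t q) w = b])))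
  <= mesh t q * `|Q l a b| + C * mesh t q ^+ 2.
Proof.
have [C C0 H] := @expmx_small_step R n (Q l) (mesh t) (mesh_gt0 t0) (cvg_mesh t).
exists C => //; apply: filterS H => q Hq u a b u0 ab.
have h0 := mesh_gt0 t0 q.
rewrite transition_law ?(ltW h0)//.
have mEu : measurable (E l `&` [set w | X u w = a]).
  by apply: measurableI => //; exact: measurable_state.
have p0 : 0 <= fine (P (E l `&` [set w | X u w = a])) by rewrite fine_ge0.
have p1 : fine (P (E l `&` [set w | X u w = a])) <= 1.
  by rewrite -[leRHS]/(fine 1%E) fine_le ?fin_num_measure// probability_le1.
apply: (@le_trans _ _ `|expmx (mesh t q *: Q l) a b|).
  apply: (le_trans (ler_norm _)); rewrite normrM ler_piMl// ger0_norm//.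
have := Hq a b; rewrite (negbTE ab) add0r => Hab.
rewrite -{2}(gtr0_norm h0) -normrM -lerBlDl (le_trans _ Hab)//.
exact: lerB_dist.
Qed.

Lemma sum_grid_const (c : R) q :
  (\sum_(i <- iota 0 (2 ^ q)) (c * mesh t q)%:E)%E = (c * t)%:E.
Proof.
rewrite sumEFin big_const_seq count_predT size_iota iter_addr addr0.
congr EFin; rewrite -[X in _ = _ * X](grid_end t q) /grid.
by rewrite mulr_natl mulrnAr.
Qed.

Lemma measurable_step u h a b l : 0 <= u -> 0 <= h ->
  measurable (E l `&` ([set w | X u w = a] `&` [set w | X (u + h) w = b])).
Proof.
move=> u0 h0; apply: measurableI => //; apply: measurableI.
  exact: measurable_state.
by apply: measurable_state; rewrite addr_ge0.
Qed.

Lemma null_of_le (A : set T) : measurable A ->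
  (forall e : R, 0 < e -> (P A <= e%:E)%E) -> P A = 0%E.
Proof.
move=> mA H; apply/eqP; rewrite -measure_le0; apply/lee_addgt0Pr => e e0.
by rewrite add0e; exact: H.
Qed.

Lemma ae_finite_jumps : {ae P, forall w, finite_set (jumps (path w) t)}.
Proof.
pose ch q (i : nat) w := X (grid t q i) w != X (grid t q i.+1) w.
have mpair q i (c : 'I_n.+1 * 'I_n.+1) :
    measurable [set w | (X (grid t q i) w, X (grid t q i.+1) w) = c].
  rewrite (_ : [set _ | _] = [set w | X (grid t q i) w = c.1] `&`
                             [set w | X (grid t q i.+1) w = c.2]).
    by apply: measurableI; apply: measurable_state; exact: grid_ge0.
  by apply/seteqP; split=> w /=; case: c => a b /= -[-> ->].
have mch q i : measurable [set w | ch q i w].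
  exact: (finite_fibres_preimage (fun c => c.1 != c.2) (fun b : bool => b : Prop)
    (sigma_algebra_measurable T) (mpair q i)).
have [D D0 HD] : exists2 D : R, 0 <= D & \forall q \near \oo, forall i,
    (P [set w | ch q i w] <= (D * mesh t q)%:E)%E.
  have H l : exists C : R, 0 <= C /\ \forall q \near \oo, forall i,
      fine (P (E l `&` [set w | ch q i w])) <= C * mesh t q.
    have [C C0 HC] := step_prob_le l.
    (* The one-step bounds are added over all pairs of states; a mesh below 1 lets the quadratic
       term be absorbed into the linear one. *)
    pose S := \sum_(c : 'I_n.+1 * 'I_n.+1) (`|Q l c.1 c.2| + C).
    exists S; split; first by apply: sumr_ge0 => c _; rewrite addr_ge0.
    have h1 : \forall q \near \oo, mesh t q < 1 by exact: (cvgr_lt _ (cvg_mesh t)).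
    apply: filterS2 HC h1 => q Hq h1 i; have h0 := mesh_gt0 t0 q.
    have mE : measurable (E l `&` [set w | ch q i w]) by exact: measurableI.
    have -> : fine (P (E l `&` [set w | ch q i w])) = \sum_c fine (P
       (E l `&` [set w | ch q i w] `&`
        [set w | (X (grid t q i) w, X (grid t q i.+1) w) = c])).
      apply: EFin_inj; rewrite fineK ?fin_num_measure//.
      rewrite (measure_fibres (mpair q i) P mE) -sumEFin.
      by apply: eq_bigr => c _; rewrite fineK// fin_num_measure//; exact: measurableI.
    rewrite mulr_suml; apply: ler_sum => -[a b] _ /=.
    have [<-|ab] := eqVneq a b.
      rewrite (_ : _ `&` _ = set0); last first.
        by rewrite -subset0 => w [[_ chw] [Xa Xb]]; move: chw; rewrite /ch /= Xa Xb eqxx.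
      by rewrite measure0 mulr_ge0 ?addr_ge0// ltW.
    have mS := @measurable_step (grid t q i) (mesh t q) a b l (grid_ge0 t0 q i) (ltW h0).
    apply: (@le_trans _ _ (fine (P (E l `&` ([set w | X (grid t q i) w = a] `&`
        [set w | X (grid t q i + mesh t q) w = b]))))).
      have mL : measurable (E l `&` [set w | ch q i w] `&`
          [set w | (X (grid t q i) w, X (grid t q i.+1) w) = (a, b)]).
        by apply: measurableI => //; exact: mpair.
      apply: fine_le; rewrite ?fin_num_measure//.
      apply: le_measure; rewrite ?inE//.
      by move=> w [[El _] [Xa Xb]]; split => //; split => //; rewrite -gridS.
    apply: (le_trans (Hq _ a b (grid_ge0 t0 q i) ab)).
    rewrite mulrDl mulrC lerD2l ler_wpM2l// expr2 ler_piMl// ltW//.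
  have [C HC] := choice H.
  exists (\sum_l C l); first by apply: sumr_ge0 => l _; have [] := HC l.
  have : \forall q \near \oo, forall l i,
      fine (P (E l `&` [set w | ch q i w])) <= C l * mesh t q.
    by apply: filter_forall => l; have [] := HC l.
  apply: filterS => q Hq i; rewrite -(fineK (fin_num_measure P _ (mch q i))).
  by rewrite lee_fin fine_regimes// mulr_suml; apply: ler_sum => l _; exact: Hq.
pose A M q := [set w | (M <= grid_changes (path w) t q (2 ^ q))%N].
have mA M q : measurable (A M q) by exact: (@measurable_count_ge R d T (ch q) (mch q)).
have AM M : (0 < M)%N -> \forall q \near \oo, (P (A M q) <= (D * t / M%:R)%:E)%E.
  move=> M0; apply: filterS HD => q Hq.
  have Hsum : (\sum_(i <- iota 0 (2 ^ q)) P [set w | ch q i w] <= (D * t)%:E)%E.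
    by rewrite -(sum_grid_const D q); apply: lee_sum => i _; exact: Hq.
  have := le_trans (@markov_count R d T P (ch q) (mch q) (2 ^ q) M) Hsum.
  rewrite -[X in (_ * X)%E]/(P (A M q)).
  rewrite -(fineK (fin_num_measure P _ (mA M q))) -EFinM !lee_fin.
  by rewrite ler_pdivlMr ?ltr0n// mulrC.
(* The exceptional set: for each [M], at least [M.+1] changes on all sufficiently fine grids. By
   [finite_jumps] it contains every path with infinitely many jumps. *)
pose N := \bigcap_M \bigcup_N0 \bigcap_(q in [set q | (N0 <= q)%N]) A M.+1 q.
have mL M : measurable (\bigcup_N0 \bigcap_(q in [set q | (N0 <= q)%N]) A M.+1 q).
  apply: bigcupT_measurable => N0; apply: bigcap_measurable => //.
  by exists N0 => /=.
have mN : measurable N by exact: bigcapT_measurable.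
exists N; split => //.
  apply: null_of_le => // e e0.
  (* Chosen so that [M.+1] exceeds [D * t / e], which brings the Markov bound [D * t / M.+1] below
     [e]. *)
  pose M := Num.truncn (D * t / e).
  apply: (@le_trans _ _ (P (\bigcup_N0 \bigcap_(q in [set q | (N0 <= q)%N]) A M.+1 q))).
    by apply: le_measure; rewrite ?inE// => w; apply.
  apply: probability_liminf_le => //; apply: filterS (AM M.+1 isT) => q /le_trans; apply.
  rewrite lee_fin ler_pdivrMr ?ltr0n// [e * _]mulrC -ler_pdivrMr//.
  by apply/ltW; exact: truncnS_gt.
move=> w /= nfin M _; apply: contrapT => nL; apply: nfin.
apply: (@finite_jumps R n (path w) t t0 _ M.+1).
  exact: mixture_right_continuous.
by move=> [N0 _ HN]; apply: nL; exists N0.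
Qed.

Lemma ae_no_null_transition : {ae P, forall w, finite_set (jumps (path w) t) ->
  forall a b, a != b -> Q (phi w) a b = 0 -> transition_count (path w) t a b = 0%N}.
Proof.
have H : \forall w \near almost_everywhere P, forall c : 'I_m * ('I_n.+1 * 'I_n.+1),
    phi w = c.1 -> finite_set (jumps (path w) t) -> c.2.1 != c.2.2 ->
    Q c.1 c.2.1 c.2.2 = 0 -> transition_count (path w) t c.2.1 c.2.2 = 0%N.
  apply: filter_forall => -[l [a b]] /=.
  have [->|ab] := eqVneq a b; first exact: nearW.
  have [Q0'|Q0'] := eqVneq (Q l a b) 0; last by apply: nearW => w _ _ _ /eqP; rewrite (negbTE Q0').
  pose p q (i : nat) w :=
    (phi w, X (grid t q i) w, X (grid t q i.+1) w) == (l, a, b).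
  have pE q i : [set w | p q i w] = E l `&` ([set w | X (grid t q i) w = a] `&`
      [set w | X (grid t q i + mesh t q) w = b]).
    rewrite -gridS; apply/seteqP; split=> w /=; rewrite /p.
      by move=> /eqP[-> -> ->].
    by move=> [-> [-> ->]].
  have mp q i : measurable [set w | p q i w].
    by rewrite pE; apply: measurable_step; [exact: grid_ge0|exact/ltW/mesh_gt0].
  pose A q := [set w | (1 <= count ((p q)^~ w) (iota 0 (2 ^ q)))%N].
  have mA q : measurable (A q) by exact: (@measurable_count_ge R d T (p q) (mp q)).
  have [C C0 HC] := step_prob_le l.
  have Ae (e : R) : 0 < e -> \forall q \near \oo, (P (A q) <= e%:E)%E.
    move=> e0.
    have Ch : C * mesh t q * t @[q --> \oo] --> (0 : R).
      rewrite -(mul0r t) -(mulr0 C); apply: cvgM; last exact: cvg_cst.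
      by apply: cvgM; [exact: cvg_cst|exact: cvg_mesh].
    have He : \forall q \near \oo, C * mesh t q * t < e by exact: (cvgr_lt _ Ch).
    apply: filterS2 HC He => q Hq /ltW Hle.
    have := @markov_count R d T P (p q) (mp q) (2 ^ q) 1.
    rewrite mul1e => /le_trans; apply.
    (* A quadratic bound per cell, summed over [2 ^ q] cells, leaves one factor of the mesh, which
       tends to 0. *)
    apply: (@le_trans _ _ (\sum_(i <- iota 0 (2 ^ q)) (C * mesh t q * mesh t q)%:E)%E).
      apply: lee_sum => i _; rewrite -(fineK (fin_num_measure P _ (mp q i))) lee_fin.
      rewrite pE (le_trans (Hq _ a b (grid_ge0 t0 q i) ab))//.
      by rewrite Q0' normr0 mulr0 add0r expr2 mulrA.
    by rewrite sum_grid_const lee_fin.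
  pose N := \bigcup_N0 \bigcap_(q in [set q | (N0 <= q)%N]) A q.
  have mN : measurable N.
    apply: bigcupT_measurable => N0; apply: bigcap_measurable => //.
    by exists N0 => /=.
  exists N; split => //.
    by apply: null_of_le => // e e0; apply: probability_liminf_le => //; exact: Ae.
  move=> w /= nH; apply: contrapT => nN; apply: nH => Ew fin _ _.
  apply/eqP; rewrite -leqn0 leqNgt; apply/negP => tc.
  (* Every separating grid records the transition as a step from [a] to [b], so such a path lies in
     [A q] from some [q] on. *)
  have [N0 _ HN] := near_separating fin; apply: nN; exists N0 => // q /= N0q.
  have sep := HN q N0q.
  rewrite /A /=; move: tc; rewrite -(step_count_transition t0 _ fin sep ab); last first.
    exact: mixture_right_continuous.
  rewrite /step_count; congr (0 < _)%N; apply: eq_count => i.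
  by rewrite /p Ew !xpair_eqE eqxx.
by apply: filterS H => w Hw fin a b; exact: (Hw (phi w, (a, b))).
Qed.

(** The last grid point [t] is left out, so the samples belong to the past. Tuples form a finite
    type, as the lemmas on finite fibres require. *)
Definition grid_states q w : (2 ^ q).-tuple 'I_n.+1 :=
  [tuple X (grid t q i) w | i < 2 ^ q].

Lemma nth_grid_states q w i : (i < 2 ^ q)%N ->
  nth ord0 (grid_states q w) i = X (grid t q i) w.
Proof. by move=> iq; rewrite (nth_mktuple _ ord0 (Ordinal iq)). Qed.

Lemma grid_states_fibre q (c : (2 ^ q).-tuple 'I_n.+1) :
  [set w | grid_states q w = c] =
  cylinder [seq (grid t q i, nth ord0 c i) | i <- iota 0 (2 ^ q)].
Proof.
apply/seteqP; split=> w; rewrite /cylinder /= all_map.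
  move=> <-; apply/allP => i; rewrite mem_iota add0n /= => iq.
  by rewrite nth_grid_states.
move=> /allP H; apply: eq_from_tnth => i.
have iq : (i < 2 ^ q)%N by [].
rewrite !(tnth_nth ord0) nth_grid_states//; apply/eqP/(H i).
by rewrite mem_iota.
Qed.

Lemma past_sigma_algebra : sigma_algebra setT (past_sigma X t).
Proof. exact: smallest_sigma_algebra. Qed.

Lemma past_cylinder r : all (fun p => 0 <= p.1 < t) r ->
  past_sigma X t (cylinder r).
Proof.
pose G := [set A | exists v i, 0 <= v < t /\ A = [set w | X v w = i]].
elim: r => [_|[u i] r IH /= /andP[u0 /IH mr]].
  rewrite (_ : cylinder _ = setT); last by apply/seteqP.
  exact: (@measurableT _ (g_sigma_algebraType G)).
rewrite (_ : cylinder _ = [set w | X u w = i] `&` cylinder r).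
  apply: (@measurableI _ (g_sigma_algebraType G)) => //.
  by apply: sub_sigma_algebra; exists u, i.
rewrite /cylinder; apply/seteqP; split=> [w /= /andP[/eqP Xw rw]|w /= [-> ->]].
  by split.
by rewrite eqxx.
Qed.

Lemma past_measurable A : past_sigma X t A -> measurable A.
Proof.
apply: smallest_sub; first exact: sigma_algebra_measurable.
by move=> _ [u [i [/andP[u0 _] ->]]]; exact: measurable_state.
Qed.

Lemma past_grid_states q c : past_sigma X t [set w | grid_states q w = c].
Proof.
rewrite grid_states_fibre; apply: past_cylinder; apply/allP => _ /mapP[i + ->].
rewrite mem_iota add0n /= => iq.
by rewrite grid_ge0//= -[ltRHS](grid_end t q) grid_lt.
Qed.

Definition posterior q w : R :=
  cprob P (E k) ([set w' | grid_states q w' = grid_states q w] `&` B).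

Let mK q c : measurable [set w | grid_states q w = c].
Proof. by apply: past_measurable; exact: past_grid_states. Qed.

Lemma posterior_itv q w : 0 <= posterior q w <= 1.
Proof. by apply: cprob_itv => //; exact: measurableI. Qed.

Lemma past_posterior q U : past_sigma X t (posterior q @^-1` U).
Proof.
exact: (finite_fibres_preimage
  (fun c => cprob P (E k) ([set w' | grid_states q w' = c] `&` B))
  U past_sigma_algebra (@past_grid_states q)).
Qed.

Definition limit_posterior w : R :=
  s k 0 (X 0 w) * path_likelihood (Q k) (path w) t /
    \sum_l s l 0 (X 0 w) * path_likelihood (Q l) (path w) t.

Lemma path_likelihood_ge0 l w : 0 <= path_likelihood (Q l) (path w) t.
Proof.
apply: prodr_ge0 => a _; rewrite mulr_ge0 ?expR_ge0//.
by apply: prodr_ge0 => b ba; rewrite exprn_ge0// Q0// eq_sym.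
Qed.

(** By [grid_cylinder_law] every regime carries the same factor, the initial probability times
    [jump_scale]; once it cancels, [cvg_grid_weight] gives the limit of each remaining term. *)
Lemma cvg_posterior w : X t w = j -> finite_set (jumps (path w) t) ->
  pi0 (X 0 w) 0 * s (phi w) 0 (X 0 w) != 0 ->
  (forall a b, a != b -> Q (phi w) a b = 0 ->
    transition_count (path w) t a b = 0%N) ->
  posterior q w @[q --> \oo] --> limit_posterior w.
Proof.
move=> Bw fin; rewrite mulf_eq0 => /norP[pi_neq0 s_neq0] nt.
pose W l q := grid_weight (Q l) (path w) t q / jump_scale (path w) t q.
(* Observing [X t w = j] supplies the last grid point, which turns the samples into a cylinder with
   [2 ^ q] steps. *)
have gridE q : [set w' | grid_states q w' = grid_states q w] `&` B =
    grid_cylinder t q (2 ^ q) (fun i => X (grid t q i) w).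
  rewrite grid_states_fibre /cylinder /grid_cylinder -[(2 ^ q).+1]addn1 iotaD add0n.
  have H i : i \in iota 0 (2 ^ q) ->
      nth ord0 (grid_states q w) i = X (grid t q i) w.
    by rewrite mem_iota add0n => /andP[_ iq]; rewrite nth_grid_states.
  apply/seteqP; split=> w'; rewrite /= all_cat all_map /= andbT grid_end.
    move=> [/allP Hw Bw']; rewrite Bw' Bw eqxx andbT; apply/allP => i iq.
    by rewrite -H//; exact: Hw.
  move=> /andP[/allP Hw /eqP ->]; split => //; apply/allP => i iq /=.
  by rewrite H//; exact: Hw.
have mgrid q : measurable (grid_cylinder t q (2 ^ q) (fun i => X (grid t q i) w)).
  by rewrite -gridE; exact: measurableI.
have law q l : fine (P (E l `&` grid_cylinder t q (2 ^ q) (fun i => X (grid t q i) w))) =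
    (pi0 (X 0 w) 0 * jump_scale (path w) t q) * (s l 0 (X 0 w) * W l q).
  rewrite grid_cylinder_law// /W /grid_weight /grid mul0r.
  by field; rewrite gt_eqF// jump_scale_gt0.
have postE q : posterior q w = s k 0 (X 0 w) * W k q / \sum_l s l 0 (X 0 w) * W l q.
  rewrite /posterior gridE /cprob (fine_regimes (mgrid q)) law.
  rewrite (eq_bigr _ (fun l _ => law q l)) -mulr_sumr invfM mulrACA divff ?mul1r//.
  by rewrite mulf_neq0// gt_eqF// jump_scale_gt0.
under eq_fun do rewrite postE.
have rc u : 0 <= u -> \forall v \near u^'+, path w v = path w u.
  exact: mixture_right_continuous.
have Wcvg l : s l 0 (X 0 w) * W l q @[q --> \oo] -->
    s l 0 (X 0 w) * path_likelihood (Q l) (path w) t.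
  by apply: cvgM; [exact: cvg_cst|exact: cvg_grid_weight].
apply: cvgM; first exact: Wcvg.
apply: cvgV; last by apply: cvg_big => [|l _]; [exact: add_continuous|exact: Wcvg].
(* The regime actually followed by the path contributes a positive term: its rate is positive at
   every transition that occurs. *)
rewrite gt_eqF// (bigD1 (phi w))//=.
rewrite ltr_wpDr//; first by apply: sumr_ge0 => l _; rewrite mulr_ge0// path_likelihood_ge0.
rewrite mulr_gt0//; first by rewrite lt_neqAle eq_sym s_neq0 s0.
apply: prodr_gt0 => a _; rewrite mulr_gt0 ?expR_gt0//; apply: prodr_gt0 => b ba.
have ab : a != b by rewrite eq_sym.
have [Qab|Qab] := eqVneq (Q (phi w) a b) 0; first by rewrite nt// expr0.
by rewrite exprn_gt0// lt_neqAle eq_sym Qab Q0.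
Qed.

(** An upper limit exists for every path and inherits measurability with respect to the past from
    the grid posteriors. The explicit ratio is identified with it only almost surely on
    [X t w = j]. *)
Definition full_posterior w : R := limn_sup (fun q => posterior q w).

Let posterior_ub w : has_ubound (range (fun q => posterior q w)).
Proof. by exists 1 => _ [q _ <-]; have /andP[] := posterior_itv q w. Qed.

Let posterior_lb w : has_lbound (range (fun q => posterior q w)).
Proof. by exists 0 => _ [q _ <-]; have /andP[] := posterior_itv q w. Qed.

Lemma past_full_posterior U : measurable U ->
  past_sigma X t (full_posterior @^-1` U).
Proof.
move=> mU; pose G := [set A | exists v i, 0 <= v < t /\ A = [set w | X v w = i]].
have := @measurable_fun_limn_sup _ (g_sigma_algebraType G) R setT
  (fun q w => posterior q w) _ _ _ measurableT U mU.
rewrite setTI; apply => //.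
by move=> q _ V mV; rewrite setTI; exact: past_posterior.
Qed.

Let measurable_full_posterior : measurable_fun setT full_posterior.
Proof.
by move=> _ U mU; rewrite setTI; apply: past_measurable; exact: past_full_posterior.
Qed.

Let measurable_posterior q : measurable_fun setT (posterior q).
Proof. by move=> _ U mU; rewrite setTI; apply: past_measurable; exact: past_posterior. Qed.

Let full_posterior_itv w : 0 <= full_posterior w <= 1.
Proof.
pose u q := posterior q w.
have cv : cvgn (sups u).
  apply: (cvgP (inf (range (sups u)))).
  by apply: cvg_sups_inf; [exact: posterior_ub|exact: posterior_lb].
have ub q : has_ubound (sdrop u q) by apply: has_ubound_sdrop; exact: posterior_ub.
have uq q : sdrop u q (u q) by exists q => /=.
apply/andP; split.
  apply: limr_ge => //; apply: nearW => q.
  by apply: le_trans (ub_le_sup (ub q) (uq q)); have /andP[] := posterior_itv q w.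
apply: limr_le => //; apply: nearW => q; apply: ge_sup; first by exists (u q).
by move=> _ [p _ <-]; have /andP[] := posterior_itv p w.
Qed.

Lemma ae_cvg_posterior : {ae P, forall w, X t w = j ->
  posterior q w @[q --> \oo] --> limit_posterior w}.
Proof.
apply: filterS3 ae_initial ae_finite_jumps ae_no_null_transition.
by move=> w pw fin nt Bw; apply: cvg_posterior => //; exact: nt.
Qed.

Lemma ae_full_posterior :
  {ae P, forall w, X t w = j -> full_posterior w = limit_posterior w}.
Proof.
apply: filterS ae_cvg_posterior => w H Bw; apply/cvg_lim => //.
by apply: cvg_sups; exact: H.
Qed.

(* Observation times are rounded up to the grid, so that right-continuity makes
   the rounding harmless in the limit. *)
Definition rounded q (r : seq (R * 'I_n.+1)) (c : (2 ^ q).-tuple 'I_n.+1) : bool :=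
  all (fun p => nth ord0 c (grid_index t q p.1) == p.2) r.

Lemma near_rounded r w : all (fun p => 0 <= p.1 < t) r ->
  \forall q \near \oo, rounded r (grid_states q w) = all (fun p => X p.1 w == p.2) r.
Proof.
elim: r => [_|[u i] r IH /= /andP[/andP[u0 ut] /IH Hr]]; first exact: nearW.
(* This keeps the rounded time strictly before [t], hence among the samples in [grid_states]. *)
have mt : \forall q \near \oo, mesh t q < t - u.
  by apply: (cvgr_lt _ (cvg_mesh t)); rewrite subr_gt0.
have rc v : 0 <= v -> \forall v' \near v^'+, path w v' = path w v.
  exact: mixture_right_continuous.
have xu := grid_index_path t0 rc u0.
apply: filterS3 Hr mt xu => q Hr mt xu.
rewrite /rounded /= in Hr *; rewrite Hr nth_grid_states ?xu//.
rewrite -(grid_lt t0 q) grid_end (lt_trans (grid_index_lt t0 q u0))//.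
by rewrite addrC -ltrBrDr.
Qed.

(** The rounded cylinder depends on the grid states alone, so [integral_cprob_fibres] gives the
    identity for each [q]. Placing indicators in the integrands fixes the domain [B], and bounded
    convergence passes to the limit on both sides. *)
Lemma cylinder_posterior r : all (fun p => 0 <= p.1 < t) r ->
  P (E k `&` (cylinder r `&` B)) =
  (\int[P]_(w in cylinder r `&` B) (full_posterior w)%:E)%E.
Proof.
move=> tr; have mr : measurable (cylinder r) by apply: past_measurable; exact: past_cylinder.
pose A q := [set w | rounded r (grid_states q w)].
have mA q : measurable (A q).
  exact: (finite_fibres_preimage (rounded (q:=q) r) (fun b : bool => b : Prop)
    (sigma_algebra_measurable T) (@mK q)).
pose u q w : R := \1_(A q) w * \1_(E k) w.
pose v q w : R := \1_(A q) w * posterior q w.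
have uv q : (\int[P]_(w in B) (u q w)%:E = \int[P]_(w in B) (v q w)%:E)%E.
  rewrite !integral_indicM integral_indic//; last exact: measurableI.
  exact: (integral_cprob_fibres P (rounded (q:=q) r) (@mK q) (hphi k) mB).
have nA w : \forall q \near \oo, \1_(A q) w = \1_(cylinder r) w :> R.
  apply: filterS (near_rounded w tr) => q H; rewrite !indicE; congr (_%:R).
  by congr nat_of_bool; apply/idP/idP; rewrite !inE /A /cylinder /= H.
have indic_le1 (D : set T) w (x : R) : 0 <= x <= 1 -> `|\1_D w * x| <= 1.
  move=> /andP[x0 x1]; rewrite indicE; case: (_ \in _); last by rewrite mul0r normr0.
  by rewrite mul1r ger0_norm.
have ucvg : (\int[P]_(w in B) (u q w)%:E @[q --> \oo] -->
    \int[P]_(w in B) (\1_(cylinder r) w * \1_(E k) w)%:E)%E.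
  apply: bounded_convergence => //.
  - by move=> q; apply: measurable_funM; exact: measurable_indic.
  - by apply: measurable_funM; exact: measurable_indic.
  - apply: nearW => w _; apply: cvgM; last exact: cvg_cst.
    by apply: cvg_near_cst; exact: nA.
  - by move=> q w; apply: indic_le1; rewrite indicE ler0n lern1 leq_b1.
have vcvg : (\int[P]_(w in B) (v q w)%:E @[q --> \oo] -->
    \int[P]_(w in B) (\1_(cylinder r) w * full_posterior w)%:E)%E.
  apply: bounded_convergence => //.
  - by move=> q; apply: measurable_funM => //; exact: measurable_indic.
  - by apply: measurable_funM => //; exact: measurable_indic.
  - apply: filterS2 ae_cvg_posterior ae_full_posterior => w Hw Ew Bw.
    apply: cvgM; first by apply: cvg_near_cst; exact: nA.
    by rewrite Ew//; exact: Hw.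
  - by move=> q w; apply: indic_le1; exact: posterior_itv.
have <- : (\int[P]_(w in B) (\1_(cylinder r) w * \1_(E k) w)%:E)%E =
    P (E k `&` (cylinder r `&` B)).
  by rewrite integral_indicM integral_indic//; exact: measurableI.
rewrite -integral_indicM -(cvg_lim _ ucvg)// -(cvg_lim _ vcvg)//.
by under eq_fun do rewrite uv.
Qed.

Lemma past_posterior_integral A : past_sigma X t A ->
  P (E k `&` (A `&` B)) = (\int[P]_(w in A `&` B) (full_posterior w)%:E)%E.
Proof.
have mEfp D : measurable_fun D (EFin \o full_posterior).
  by apply: measurable_funTS; exact/measurable_EFinP.
have fp0 w : (0 <= (full_posterior w)%:E)%E.
  by rewrite lee_fin; have /andP[] := full_posterior_itv w.
pose G := [set cylinder r | r in [set r | all (fun p => 0 <= p.1 < t) r]].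
pose H := [set A | measurable A /\ P (E k `&` (A `&` B)) =
  (\int[P]_(w in A `&` B) (full_posterior w)%:E)%E].
have cylinderI r1 r2 : cylinder r1 `&` cylinder r2 = cylinder (r1 ++ r2).
  apply/seteqP; split=> w; rewrite /cylinder /= all_cat.
    by move=> [-> ->].
  by move=> /andP[].
have GH : G `<=` H.
  move=> _ [r tr <-]; split; last exact: cylinder_posterior.
  by apply: past_measurable; exact: past_cylinder.
have HT : H setT.
  have := GH (cylinder [::]); rewrite (_ : cylinder [::] = setT); last by apply/seteqP.
  by apply; exists [::] => //; apply/seteqP.
have dH : dynkin H.
  split => //.
    move=> D [mD DE]; split; first exact: measurableC.
    have mDB : measurable (D `&` B) by exact: measurableI.
    have mCB : measurable (~` D `&` B) by apply: measurableI => //; exact: measurableC.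
    have Bsplit : B = (D `&` B) `|` (~` D `&` B) by rewrite -setIUl setUv setTI.
    have disj : [disjoint D `&` B & ~` D `&` B].
      by apply/disj_setPS => w [[Dw _] [nDw _]].
    have PU : P (E k `&` B) = (P (E k `&` (D `&` B)) + P (E k `&` (~` D `&` B)))%E.
      rewrite {1}Bsplit setIUr measureU//; [exact: measurableI|exact: measurableI|].
      by rewrite -subset0 => w [[_ [Dw _]] [_ [nDw _]]].
    have IU : (\int[P]_(w in B) (full_posterior w)%:E = \int[P]_(w in D `&` B)
        (full_posterior w)%:E + \int[P]_(w in ~` D `&` B) (full_posterior w)%:E)%E.
      by rewrite {1}Bsplit ge0_integral_setU//; exact: mEfp.
    (* The identity for the complement is the one for the whole space minus the one for [D];
       cancellation is legitimate because probabilities are finite. *)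
    have [_] := HT; rewrite setTI PU IU -DE.
    have mED : measurable (E k `&` (D `&` B)) by exact: measurableI.
    move=> /(congr1 (fun y => y - P (E k `&` (D `&` B)))%E).
    by rewrite ![(P (E k `&` (D `&` B)) + _)%E]addeC !addeK ?fin_num_measure.
  move=> F tF HF; have mF i : measurable (F i) by have [] := HF i.
  split; first exact: bigcupT_measurable.
  have mFB i : measurable (F i `&` B) by exact: measurableI.
  have tFB : trivIset setT (fun i => F i `&` B).
    by move=> i i' _ _ [w [[Fi _] [Fi' _]]]; apply: tF => //; exists w.
  rewrite setI_bigcupl (ge0_integral_bigcup P mFB (mEfp _) (fun w _ => fp0 w) tFB).
  rewrite setI_bigcupr measure_bigcup//; last 2 first.
  - by move=> i _; exact: measurableI.
  - by move=> i i' _ _ [w [[_ [Fi _]] [_ [Fi' _]]]]; apply: tF => //; exists w.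
  transitivity (\sum_(0 <= i <oo) P (E k `&` (F i `&` B)))%E.
    by apply: eq_eseriesl => i; rewrite in_setT.
  by apply: eq_eseriesr => i _; have [] := HF i.
suff : past_sigma X t `<=` H by move=> /(_ A) sub /sub[].
(* Events at a single time generate the past but are not stable under intersection. Cylinders are,
   and they include the single-time events. *)
apply: (@subset_trans _ (<<s G>>)).
  apply: smallest_sub; first exact: smallest_sigma_algebra.
  move=> _ [v [i [v0t ->]]]; apply: sub_sigma_algebra; exists [:: (v, i)].
    by rewrite /= v0t.
  by apply/seteqP; split=> w; rewrite /cylinder /= andbT => /eqP.
apply: lambda_system_subset => //; last exact/dynkin_lambda_system.
move=> _ _ [r1 tr1 <-] [r2 tr2 <-]; exists (r1 ++ r2) => //.
by rewrite /= all_cat tr1.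
Qed.

Lemma full_information_posterior : exists2 g : T -> R,
  is_cond_prob P (past_sigma X t) B (E k) g &
  {ae P, forall w, X t w = j -> g w = limit_posterior w}.
Proof.
exists full_posterior; last exact: ae_full_posterior.
split.
- exact: past_full_posterior.
- apply: (@le_integrable _ _ _ _ _ _ _ (EFin \o cst 1)) => //.
  + by apply: measurable_funTS; exact/measurable_EFinP.
  + move=> w _; rewrite /= lee_fin normr1.
    by have /andP[g0 g1] := full_posterior_itv w; rewrite ger0_norm.
  + exact: finite_measure_integrable_cst.
- exact: past_posterior_integral.
Qed.

End full_information.

End mixture_law.

(** * Time zero *)

Lemma path_likelihood_time0 (R : realType) (n : nat) (Q : 'M[R]_n.+1)
    (x : R -> 'I_n.+1) : path_likelihood Q x 0 = 1.
Proof.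
have occ l : occupation_time x 0 l = 0.
  rewrite /occupation_time (_ : [set u | _] = if x 0 == l then [set 0] else set0).
    by case: ifP => _; rewrite ?lebesgue_measure_set1 ?measure0.
  apply/seteqP; split=> u /=; rewrite -eq_le.
    by move=> [/eqP <- ->]; rewrite eqxx.
  by case: eqP => // x0 ->.
have tc l r : transition_count x 0 l r = 0%N.
  rewrite /transition_count (_ : [set u | _] = set0) ?fset_set0 ?cardfs0//.
  by rewrite -subset0 => u [/andP[u0 /le_lt_trans/(_ u0)]]; rewrite ltxx.
apply: big1 => l _; rewrite occ mulr0 expR0 mul1r big1// => r _.
by rewrite tc expr0.
Qed.

(** No time satisfies [0 <= s < 0], so the generating family is empty. *)
Lemma past_sigma_time0 (R : realType) (n : nat) (T : Type)
    (X : R -> T -> 'I_n.+1) (A : set T) :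
  past_sigma X 0 A -> A = set0 \/ A = setT.
Proof.
suff : past_sigma X 0 `<=` [set A | A = set0 \/ A = setT] by exact.
apply: smallest_sub; last first.
  by move=> D [u [i [/andP[u0 u1] _]]]; have := le_lt_trans u0 u1; rewrite ltxx.
split; first by left.
  by move=> _ [->|->]; rewrite setTD ?setC0 ?setCT; [right|left].
move=> F HF; have [[i Fi]|nF] := pselect (exists i, F i = setT).
  by right; rewrite -subTset => w _; exists i => //; rewrite Fi.
left; rewrite -subset0 => w [i _ Fw].
by have [F0|FT] := HF i; [rewrite F0 in Fw|case: nF; exists i].
Qed.

Section initial_time.
Context (R : realType) (n m : nat) (d : measure_display)
  (T : measurableType d) (P : probability T R).
Variables (Q : 'I_m -> 'M[R]_n.+1) (Xk : 'I_m -> R -> T -> 'I_n.+1)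
  (phi : T -> 'I_m) (pi0 : 'cV[R]_n.+1) (s : 'I_m -> 'rV[R]_n.+1).
Hypotheses (hphi : forall k, measurable [set w | phi w = k])
  (hX : forall k,
     markov_jump (cond_law P [set w | phi w = k]) (Q k) (Xk k))
  (hpi : forall i, P [set w | mixture phi Xk 0 w = i] = (pi0 i 0)%:E)
  (hs : forall i k, P [set w | mixture phi Xk 0 w = i] != 0%E ->
     cprob P [set w | phi w = k] [set w | mixture phi Xk 0 w = i] = s k 0 i).

Lemma time0_cond_prob j k :
  is_cond_prob P (past_sigma (mixture phi Xk) 0) [set w | mixture phi Xk 0 w = j]
    [set w | phi w = k] (cst (s k 0 j)).
Proof.
have mB : measurable [set w | mixture phi Xk 0 w = j].
  exact: (measurable_state hphi hX).
have mE : measurable [set w | phi w = k] by [].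
split.
- move=> U mU; rewrite preimage_cst.
  pose G := [set A | exists u i, 0 <= u < 0 /\ A = [set w | mixture phi Xk u w = i]].
  by case: ifP => _; [exact: (@measurableT _ (g_sigma_algebraType G))|
                      exact: (@measurable0 _ (g_sigma_algebraType G))].
- exact: finite_measure_integrable_cst.
- move=> A /past_sigma_time0[->|->].
    by rewrite set0I setI0 measure0 integral_set0.
  rewrite setTI (eq_integral (cst (s k 0 j)%:E))// integral_cst//.
  transitivity ((s k 0 j)%:E * (pi0 j 0)%:E)%E; last by rewrite -hpi.
  rewrite -EFinM mulrC -(initial_law hphi hX hpi hs).
  by rewrite fineK// fin_num_measure//; exact: measurableI.
Qed.

End initial_time.

(** * The Bayesian update under each kind of information *)

Theorem proposition2p1 (R : realType) (n m : nat) (d : measure_display)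
    (T : measurableType d) (P : probability T R)
    (Q : 'I_m -> 'M[R]_n.+1) (Xk : 'I_m -> R -> T -> 'I_n.+1)
    (phi : T -> 'I_m) (pi0 : 'cV[R]_n.+1) (s : 'I_m -> 'rV[R]_n.+1)
    (hQ : forall k, is_intensity (Q k))
    (hphi : forall k, measurable [set w | phi w = k])
    (hX : forall k,
       markov_jump (cond_law P [set w | phi w = k]) (Q k) (Xk k))
    (hpi : forall i, P [set w | mixture phi Xk 0 w = i] = (pi0 i 0)%:E)
    (hs : forall i k, P [set w | mixture phi Xk 0 w = i] != 0%E ->
       cprob P [set w | phi w = k] [set w | mixture phi Xk 0 w = i] = s k 0 i)
    (hs01 : forall i k, 0 <= s k 0 i <= 1)
    (hs1 : forall i, \sum_k s k 0 i = 1) :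
  let X := mixture phi Xk in
  forall (t : R) (j : 'I_n.+1) (k : 'I_m), 0 <= t ->
  [/\ (* past information given by an event *)
      forall F : set T, past_sigma X t F ->
        P (F `&` [set w | X t w = j]) != 0%E ->
        cprob P [set w | phi w = k] (F `&` [set w | X t w = j])
        = bayes_update pi0 s (event_likelihood P phi X t F) j k,
      (* past information given by the realization of a random element *)
      forall (d' : measure_display) (Z : measurableType d') (Y : T -> Z)
        (nu : {measure set Z -> \bar R}) (L : 'I_m -> Z -> 'M[R]_n.+1),
        (forall V, measurable V -> past_sigma X t (Y @^-1` V)) ->
        is_likelihood P phi X t Y nu L ->
        is_cond_prob P (g_sigma_algebra_preimage Y) [set w | X t w = j]
          [set w | phi w = k]
          (fun w => bayes_update pi0 s (fun l => L l (Y w)) j k),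
      (* (i) *)
      exists2 g : T -> R,
        is_cond_prob P (past_sigma X t) [set w | X t w = j]
          [set w | phi w = k] g &
        {ae P, forall w, X t w = j ->
           g w = s k 0 (X 0 w) * path_likelihood (Q k) (X ^~ w) t /
             \sum_l s l 0 (X 0 w) * path_likelihood (Q l) (X ^~ w) t},
      (* (ii) *)
      P [set w | X t w = j] != 0%E ->
        cprob P [set w | phi w = k] [set w | X t w = j]
        = bayes_update pi0 s (fun l => expmx (t *: Q l)) j k &
      (* (iii) *)
      forall i0 : 'I_n.+1,
        P ([set w | X 0 w = i0] `&` [set w | X t w = j]) != 0%E ->
        cprob P [set w | phi w = k]
          ([set w | X 0 w = i0] `&` [set w | X t w = j])
        = bayes_update (delta_mx i0 0) s (fun l => expmx (t *: Q l)) j k].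
Proof.
move=> X t j k t0.
have s_ge0 i l : 0 <= s l 0 i by have /andP[] := hs01 i l.
have past_meas F : past_sigma X t F -> measurable F.
  apply: smallest_sub; first exact: sigma_algebra_measurable.
  by move=> _ [u [i [/andP[u0 _] ->]]]; exact: (measurable_state hphi hX).
have mX u i : 0 <= u -> measurable [set w | X u w = i].
  exact: (measurable_state hphi hX).
split.
- move=> F /past_meas mF _.
  apply: (cprob_bayes_update hphi k (oner_neq0 R)).
    by apply: measurableI => //; exact: mX.
  by move=> l; rewrite mul1r; exact: (event_likelihood_regime hphi hX hpi hs).
- move=> d' Z Y nu L mY LY; apply: (random_element_bayes hphi hX hpi hs j k t0 _ LY) => //.
  by move=> _ V mV; rewrite setTI; apply: past_meas; exact: mY.
(* The grids need a positive mesh, so time 0 is separate: all path likelihoods are then 1, and [hs1]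
   makes the denominator 1. *)
- have [t_eq0|t_neq0] := eqVneq t 0.
    rewrite t_eq0; exists (cst (s k 0 j)); first exact: (time0_cond_prob hphi hX hpi hs).
    apply: nearW => w ->; under eq_bigr do rewrite path_likelihood_time0 mulr1.
    by rewrite path_likelihood_time0 mulr1 hs1 divr1.
  have {}t0 : 0 < t by rewrite lt_neqAle eq_sym t_neq0.
  have Q0 l a b : a != b -> 0 <= Q l a b by have [+ _] := hQ l; apply.
  exact: (full_information_posterior hphi hX hpi hs j k t0 Q0 s_ge0).
- move=> _; apply: (cprob_bayes_update hphi k (oner_neq0 R)).
    exact: mX.
  by move=> l; rewrite mul1r; exact: (state_regime hphi hX hpi hs).
- move=> i0 P0.
  (* The initial probability of [i0] is the common factor to cancel; it is nonzero because the
     conditioning event lies in [X 0 w = i0]. *)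
  have pi_neq0 : pi0 i0 0 != 0.
    apply: contra_neq P0 => pi_eq0; apply/eqP; rewrite -measure_le0.
    have <- : P [set w | X 0 w = i0] = 0%E by rewrite hpi pi_eq0.
    have mI : measurable ([set w | X 0 w = i0] `&` [set w | X t w = j]).
      by apply: measurableI; exact: mX.
    by apply: le_measure; rewrite ?inE//; exact: mX.
  apply: (cprob_bayes_update hphi k pi_neq0).
    by apply: measurableI; exact: mX.
  by move=> l; exact: (initial_state_regime hphi hX hpi hs).
Qed.
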